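(* Let $x,z$ be nonnegative integers with $x\equiv z\pmod 2$, let $\mathbf a=(a_1,\dots,a_m)$, $\mathbf b=(b_1,\dots,b_n)$, $\mathbf c=(c_1,\dots,c_k)$ be sequences of nonnegative integers with $m,n,k$ positive even integers, and let $y\ge -1$ be an integer, where $y=-1$ is allowed only when $a<b$. Put $h=\frac{x+z}{2}$, $\mu=\max(a,b)$, $\nu=\min(a,b)$. Then \begin{align*} \operatorname{M}(Q^{\nwarrow}_{x,y,z}(\mathbf a;\mathbf c;\mathbf b))=&\operatorname{M}(C_{x,2y+z+2\mu+1,z}(c))\\ &\times s\left(a_1,\dots,a_{m-1},a_m+h,c_1,\dots,c_{k-1},c_k+h+b_n,b_{n-1},\dots,b_1\right)\\ &\times s\left(y+b-\nu,a_1,\dots,a_m,h+c_1,c_2,\dots,c_k,h,b_n,\dots,b_1,y+a+1-\nu\right)\\ &\times\frac{\operatorname{H}(c+h)}{\operatorname{H}(c)\operatorname{H}(h)}\frac{\operatorname{H}(\mu+y+h)}{\operatorname{H}(\mu+c+y+h)}\\ &\times \frac{\operatorname{H}(\mu+y+z+1)\operatorname{H}(\mu+c+y+z)}{\operatorname{H}(o_a+o_b+o_c+z)\operatorname{H}(|a-b|+e_a+e_b+e_c+2y+z+1)}\\ &\times \frac{\operatorname{H}(o_a+o_b+o_c)\operatorname{H}(|a-b|+e_a+e_b+e_c+2y+1)}{\operatorname{H}(\mu+y)\operatorname{H}(\mu+y+1)}. \end{align*}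
   Context: Work on the triangular lattice drawn with horizontal lattice lines. A lozenge is the union of two unit triangles sharing an edge; a (lozenge) tiling of a region is a covering by lozenges without gaps or overlaps; $\operatorname{M}(R)$ denotes the number of tilings of $R$. Vertical distances are measured in rows (the height of a unit triangle); ''the horizontal lattice line at level $t$ above a point $P$'' is the horizontal lattice line $t$ rows above $P$. Lattice hexagons have all angles $120^\circ$ and their side-lengths are listed clockwise starting from the horizontal top side: north, northeast, southeast, south, southwest, northwest. The east vertex is the common vertex of the northeast and southeast sides; the west vertex is the common vertex of the southwest and northwest sides. Hyperfactorial: $\operatorname{H}(n)=0!\,1!\cdots(n-1)!$ for nonnegative integers $n$ ($\operatorname{H}(0)=1$). For a sequence $\mathbf t=(t_1,\dots,t_r)$ of nonnegative integers, $o_t=\sum_{i\text{ odd}}t_i$, $e_t=\sum_{i \text{ even}}t_i$, and $t=t_1+\dots+t_r$; so $a,b,c,o_a,e_a,o_b,\dots$ refer to $\mathbf a,\mathbf b,\mathbf c$. Dented semihexagon: $s(t_1,\dots,t_r)$ is the number of tilings of the region obtained from the trapezoid with horizontal top side of length $e_t$, horizontal bottom side of length $o_t+e_t$, and two slanted sides of length $o_t$, by removing from its bottom side up-pointing triangles of side-lengths $t_1,t_3,t_5,\dots$ from left to right, the first starting at the left end of the bottom side and consecutive removed triangles separated along the bottom side by distances $t_2,t_4,\dots$. (Equivalently, $s(t_1,\dots,t_{2l-1})=s(t_1,\dots,t_{2l})=\frac{1}{\operatorname{H}(t_1+t_3+\dots+t_{2l-1})}\frac{\prod_{1\le i<j\le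 2l-1,\ j-i\text{ odd}}\operatorname{H}(t_i+\dots+t_j)}{\prod_{1\le i<j\le 2l-1,\ j-i\text{ even}}\operatorname{H}(t_i+\dots+t_j)}$.) Cored hexagon: for nonnegative integers $X,Y,Z,p$, $C_{X,Y,Z}(p)$ is obtained from the hexagon $H$ with side-lengths $X,Y+p,Z,X+p,Y,Z+p$ as follows. Let $H_0$ be the hexagon with side-lengths $X,Y,Z,X,Y,Z$ whose south, southwest and northwest sides lie on the lines of the south, southwest and northwest sides of $H$; let $O$ be the center of symmetry of $H_0$. Remove the up-pointing triangle of side $p$ whose left vertex is: $O$ if $X,Y,Z$ all have the same parity; the point $1/2$ unit west of $O$ if $X$ has parity different from $Y$ and $Z$; the point $1/2$ unit from $O$ in the northwest lattice direction if $Y$ has parity different from $X$ and $Z$; the point $1/2$ unit from $O$ in the southwest lattice direction if $Z$ has parity different from $X$ and $Y$. Fern: a string of lattice triangles of side-lengths $t_1,\dots,t_r$ (side $0$ allowed) with alternating orientations, all having a horizontal side on a common horizontal lattice line $\ell$ (up-pointing ones above $\ell$, down-pointing ones below), consecutive triangles meeting at a vertex on $\ell$; it occupies a segment of $\ell$ of length $t_1+\dots+t_r$. Removing a fern means removing the union of its triangles. The region $Q^{\nwarrow}_{x,y,z}(\mathbf a;\mathbf c;\mathbf b)$ (for $x\equiv z \pmod 2$): with $O=o_a+o_b+o_c$ and $E=e_a+e_b+e_c$, let $H$ be the hexagon with side-lengths $x+E$, $y+z+O+\max(a-b,0)+1$, $y+z+E+\max(b-a,0)$, $x+O$, $y+z+E+\max(a-b,0)+1$,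 $y+z+O+\max(b-a,0)$. Let $\ell$ be the horizontal lattice line $z+O$ rows below the north side of $H$ (equivalently, at level $y+\max(a-b,0)+1$ above the east vertex); $\ell\cap H$ is a segment of length $x+z+a+b+c$ with endpoints on the northwest and northeast sides. Remove from $H$ three ferns along $\ell$: the left fern with side-lengths $a_1,\dots,a_m$ from left to right, $a_1$ up-pointing, starting at the left endpoint of $\ell\cap H$; the right fern with side-lengths $b_1,\dots,b_n$ read from right to left, $b_1$ up-pointing, ending at the right endpoint of $\ell\cap H$; and the middle fern with side-lengths $c_1,\dots,c_k$ from left to right, $c_1$ up-pointing, placed so that the distance along $\ell$ from the right end of the left fern to the left end of the middle fern and the distance from the right end of the middle fern to the left end of the right fern are both $\frac{x+z}{2}$. *)

(* Defs.v *)
From mathcomp Require Import all_boot all_order all_algebra.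
From mathcomp Require Export finmap.

Set Implicit Arguments.
Unset Strict Implicit.
Unset Printing Implicit Defensive.

Import Order.TTheory GRing.Theory Num.Theory.

Local Open Scope fset_scope.
Local Open Scope ring_scope.

(* The lattice point (i, j) is i * u + j * v, where u is the unit vector
   pointing east and v the unit vector at 60 degrees pointing northeast. Hence
   j is the level of the point, lines parallel to v are given by i = constant,
   and the remaining family of lattice lines is given by i + j = constant.
   The unit steps are E = (1, 0), NE = (0, 1), NW = (-1, 1), W = (-1, 0),
   SW = (0, -1) and SE = (1, -1). *)
Definition point : Type := (int * int)%type.

(* (true, (i, j)) is the up-pointing unit triangle whose left vertex is (i, j);
   (false, (i, j)) is the down-pointing one sharing its right edge. *)
Definition triangle : Type := (bool * (int * int))%type.

Definition vertices (t : triangle) : seq point :=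
  let: (up, (i, j)) := t in
  if up then [:: (i, j); (i + 1, j); (i, j + 1)]
  else [:: (i + 1, j); (i, j + 1); (i + 1, j + 1)].

Definition share_edge (t u : triangle) : bool :=
  (t != u) && (count (mem (vertices u)) (vertices t) == 2%N).

Definition lozenges (R : {fset triangle}) : {fset {fset triangle}} :=
  [fset [fset t; u] | t in R, u in R & share_edge t u].

Definition tilings (R : {fset triangle}) : {fset {fset {fset triangle}}} :=
  [fset T in fpowerset (lozenges R) | trivIfset T && (fcover T == R)].

Definition M (R : {fset triangle}) : nat := #|` tilings R|.

Definition int_range (lo hi : int) : seq int :=
  [seq lo + k%:Z | k <- iota 0 (absz (Num.max 0 (hi - lo))%R)].

(* The unit triangles contained in the convex lattice polygon
   i0 <= i <= i1, j0 <= j <= j1, k0 <= i + j <= k1. *)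
Definition polygon (i0 i1 j0 j1 k0 k1 : int) : {fset triangle} :=
  [fset t in [seq (up, p) | up <- [:: true; false],
                p <- [seq (i, j) | i <- int_range i0 i1, j <- int_range j0 j1]]
  | all (fun p : point => [&& i0 <= p.1 <= i1, j0 <= p.2 <= j1
                            & k0 <= p.1 + p.2 <= k1]) (vertices t)].

Arguments polygon (i0 i1 j0 j1 k0 k1)%_ring_scope.

(* (P, p) : the up-pointing triangle of side p with left vertex P. *)
Definition up_triangle (P : point) (p : nat) : {fset triangle} :=
  polygon P.1 (P.1 + p%:Z) P.2 (P.2 + p%:Z) (P.1 + P.2) (P.1 + P.2 + p%:Z).

(* (P, p) : the down-pointing triangle of side p with upper left vertex P. *)
Definition down_triangle (P : point) (p : nat) : {fset triangle} :=
  polygon P.1 (P.1 + p%:Z) (P.2 - p%:Z) P.2 (P.1 + P.2) (P.1 + P.2 + p%:Z).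

(* West vertex at (0, 0). For a closed hexagon, n + ne = s + sw and
   ne + se = sw + nw, so that the sides ne and se are redundant. *)
Definition hexagon (n ne se s sw nw : int) : {fset triangle} :=
  polygon 0 (s + sw) (- sw) nw 0 (n + nw).
Arguments hexagon (n ne se s sw nw)%_ring_scope.

Definition hyperfactorial (n : nat) : nat := (\prod_(i < n) i`!)%N.

(* Only meaningful for nonnegative n. *)
Definition H (n : int) : rat := (hyperfactorial (absz n))%:R.
Arguments H n%_ring_scope.

(* Sequences are indexed from 1 in o_t and e_t, and from 0 by nth. *)
Definition osum (t : seq nat) : nat :=
  (\sum_(i < size t | ~~ odd i) nth 0 t i)%N.
Definition esum (t : seq nat) : nat :=
  (\sum_(i < size t | odd i) nth 0 t i)%N.

(* Dents of sizes t_1, t_3, ... at distances t_2, t_4, ..., starting at P. *)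
Fixpoint dents (P : point) (t : seq nat) : {fset triangle} :=
  match t with
  | [::] => fset0
  | [:: p] => up_triangle P p
  | [:: p, d & t'] =>
      up_triangle P p `|` dents (P.1 + p%:Z + d%:Z, P.2) t'
  end.

(* The lower left corner of the trapezoid is (0, 0). *)
Definition dented_semihexagon (t : seq nat) : {fset triangle} :=
  let o := (osum t)%:Z in let e := (esum t)%:Z in
  polygon 0 (o + e) 0 o 0 (o + e) `\` dents (0, 0) t.

Definition s (t : seq nat) : nat := M (dented_semihexagon t).

(* The hexagons H and H_0 have the same west vertex (0, 0), so twice the center
   of H_0 is (X + Y, Z - Y); the shift by half a unit makes both halvings
   exact. *)
Definition core_vertex (X Y Z : nat) : point :=
  let shift : int * int :=
    if (odd X == odd Y) && (odd Y == odd Z) then (0, 0)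
    else if odd Y == odd Z then (-1, 0)
    else if odd X == odd Z then (-1, 1)
    else (0, -1) in
  (((X%:Z + Y%:Z + shift.1) %/ 2)%Z, ((Z%:Z - Y%:Z + shift.2) %/ 2)%Z).

Definition cored_hexagon (X Y Z p : nat) : {fset triangle} :=
  hexagon X (Y + p)%N Z (X + p)%N Y (Z + p)%N
    `\` up_triangle (core_vertex X Y Z) p.

Definition oriented_triangle (up : bool) (P : point) (p : nat) :=
  if up then up_triangle P p else down_triangle P p.

(* P is the left end of the fern, read from left to right. *)
Fixpoint fern_right (up : bool) (P : point) (t : seq nat) : {fset triangle} :=
  if t is p :: t' then
    oriented_triangle up P p `|` fern_right (~~ up) (P.1 + p%:Z, P.2) t'
  else fset0.

(* P is the right end of the fern, read from right to left. *)
Fixpoint fern_left (up : bool) (P : point) (t : seq nat) : {fset triangle} :=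
  if t is p :: t' then
    oriented_triangle up (P.1 - p%:Z, P.2) p
      `|` fern_left (~~ up) (P.1 - p%:Z, P.2) t'
  else fset0.

(* The removed ferns lie at level l above the west vertex (0, 0); the left end
   of the line at this level is on the northwest side, hence equal to (0, l).
   The truncated differences ab and ba are max(a - b, 0) and max(b - a, 0). *)
Definition Qnw (x : nat) (y : int) (z : nat) (a c b : seq nat)
    : {fset triangle} :=
  let O := (osum a + osum b + osum c)%N%:Z in
  let E := (esum a + esum b + esum c)%N%:Z in
  let ab := (sumn a - sumn b)%N%:Z in
  let ba := (sumn b - sumn a)%N%:Z in
  let nw := y + z%:Z + O + ba in
  let l := nw - (z%:Z + O) in
  let h := ((x + z)./2)%N in
  hexagon (x%:Z + E) (y + z%:Z + O + ab + 1) (y + z%:Z + E + ba)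
          (x%:Z + O) (y + z%:Z + E + ab + 1) nw
    `\` (fern_right true (0, l) a
         `|` fern_right true ((sumn a + h)%N%:Z, l) c
         `|` fern_left true ((x + z + sumn a + sumn b + sumn c)%N%:Z, l) b).

(* Main.v *)
Require Import Defs.
From mathcomp Require Import all_boot all_order all_algebra.
From mathcomp Require Import finmap zify ring.

(* Cut Q along the line carrying the ferns. The lozenges crossing this line occupy
   a set S of z positions in the two gaps, and each half then becomes a trapezoid
   with dents along its base: the upper dents are S and the set U of positions of
   the up-pointing triangles; the lower ones, after completing the lower half to a
   trapezoid, are S and a set D. A dented trapezoid has Delta / H(number of dents)
   tilings, Delta being the product of the differences of the dent positions, so
     M(Q) = Delta(U) Delta(D) / (H(|U| + z) H(|D| + z))
              * sum_S Delta(S)^2 prod_(i in S, j in U + D) |i - j|.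
   The union of U and D consists of three blocks of mu + y, c and mu + y + 1
   consecutive positions separated by two gaps of length h, so the sum depends only
   on mu + y, c, h and z. Cutting the cored hexagon along the base of its core
   gives the same sum with Delta computed for blocks, and the two dented
   semihexagons of the theorem are Delta(U) / H(|U|) and Delta(D) / H(|D|). *)

Set Implicit Arguments.
Unset Strict Implicit.
Unset Printing Implicit Defensive.

Import Order.TTheory GRing.Theory Num.Theory.

Local Open Scope fset_scope.
Local Open Scope nat_scope.

(** * Perfect matchings of a finite graph *)

Section Matchings.

Variable K : choiceType.
Implicit Types (e : rel K) (R : {fset K}) (t u : K).

(** With [share_edge] for [e], [nmatch] is convertible to [M]. The relation is arbitrary because
    deleting one edge of the graph changes it. *)
Definition edges e R : {fset {fset K}} :=
  [fset [fset t; u] | t in R, u in R & e t u].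

Definition matchings e R : {fset {fset {fset K}}} :=
  [fset T in fpowerset (edges e R) | trivIfset T && (fcover T == R)].

Definition nmatch e R : nat := #|` matchings e R|.

Lemma edgesP e R (A : {fset K}) :
  reflect (exists t u, [/\ t \in R, u \in R, e t u & A = [fset t; u]])
          (A \in edges e R).
Proof.
apply: (iffP idP) => [/imfset2P[t /= tR [u /= uR ->]]|[t [u [tR uR etu ->]]]].
  by move: uR; rewrite inE /= => /andP[uR etu]; exists t, u.
by apply/imfset2P; exists t => //; exists u => //; rewrite inE /= uR.
Qed.

Lemma matchingsP e R (T : {fset {fset K}}) :
  reflect [/\ {subset T <= edges e R},
              forall A B : {fset K}, A \in T -> B \in T -> forall x, x \in A -> x \in B -> A = B &
              forall x, x \in R -> exists2 A, A \in T & x \in A]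
          (T \in matchings e R).
Proof.
rewrite /matchings; apply: (iffP idP); rewrite !inE /= fpowersetE.
  case/and3P=> /fsubsetP sub /trivIfsetP triv /eqP cov; split=> //.
    move=> A B AT BT x xA xB; apply/eqP; apply: contraTT xB => AB.
    by have /fdisjointP := triv A B AT BT AB; apply.
  by move=> x; rewrite -{1}cov => /bigfcupP[A /andP[AT _] xA]; exists A.
case=> sub triv cov; apply/and3P; split; first exact/fsubsetP.
  apply/trivIfsetP => A B AT BT AB; apply/fdisjointP => x xA.
  by apply: contra AB => xB; apply/eqP; apply: triv xA xB.
apply/eqP/fsetP => x; apply/bigfcupP/idP => [[A /andP[AT _]]|/cov[A AT xA]].
  have /edgesP[t [u [tR uR _ ->]]] := sub A AT.
  by rewrite !inE => /orP[]/eqP->.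
by exists A; rewrite ?AT.
Qed.

Lemma nmatch0 e : nmatch e fset0 = 1.
Proof.
rewrite /nmatch; suff -> : matchings e fset0 = [fset fset0] by rewrite cardfs1.
apply/fsetP => T; rewrite inE; apply/matchingsP/eqP => [[sub _ _]|->].
  apply/fsetP => A; rewrite inE; apply/negP => /sub.
  by case/edgesP=> t [u [+ _]]; rewrite inE.
by split => // x; rewrite inE.
Qed.

Lemma fset2_inj t u v : [fset t; u] = [fset t; v] -> u = v.
Proof.
move=> E; have: u \in [fset t; v] by rewrite -E !inE eqxx orbT.
rewrite !inE => /orP[/eqP ut|/eqP//]; have: v \in [fset t; u].
  by rewrite E !inE eqxx orbT.
by rewrite ut !inE orbb => /eqP.
Qed.

Lemma matchings_through e R t u : e t u -> t != u -> t \in R -> u \in R ->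
  [fset T in matchings e R | [fset t; u] \in T] =
  [fset [fset t; u] |` T | T in matchings e (R `\ t `\ u)].
Proof.
move=> etu tu tR uR; apply/fsetP => T; apply/idP/imfsetP => /=.
  rewrite in_fset inE /= => /andP[/matchingsP[sub triv cov] tuT].
  exists (T `\ [fset t; u]); last by rewrite fsetD1K.
  have avoid A x : A \in T -> A != [fset t; u] -> x \in A -> x \in R ->
      x \in R `\ t `\ u.
    move=> AT Atu xA xR; rewrite !inE xR andbT; apply/andP; split.
      apply: contra Atu => /eqP xu; apply/eqP/(triv _ _ AT tuT x) => //.
      by rewrite xu !inE eqxx orbT.
    apply: contra Atu => /eqP xt; apply/eqP/(triv _ _ AT tuT x) => //.
    by rewrite xt !inE eqxx.
  apply/matchingsP; split.
  - move=> A; rewrite !inE => /andP[Atu AT].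
    have /edgesP[v [w [vR wR evw EA]]] := sub A AT.
    apply/edgesP; exists v, w; split=> //; apply: (avoid A) => //;
      by rewrite EA !inE eqxx ?orbT.
  - by move=> A B; rewrite !inE => /andP[_ AT] /andP[_ BT]; apply: triv.
  move=> x; rewrite !inE => /and3P[xu xt xR].
  have [A AT xA] := cov x xR; exists A => //; rewrite !inE AT andbT.
  apply: contraTneq xA => ->; rewrite !inE negb_or; exact/andP.
case=> T' /matchingsP[sub triv cov] ->; rewrite in_fset inE /= fset1U1 andbT.
have T'R A x : A \in T' -> x \in A -> [/\ x != u, x != t & x \in R].
  move=> /sub/edgesP[v [w [+ + _ ->]]]; rewrite !inE.
  by move=> /and3P[? ? ?] /and3P[? ? ?] /orP[]/eqP->.
apply/matchingsP; split.
- move=> A; rewrite !inE => /orP[/eqP->|AT']; first by apply/edgesP; exists t, u.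
  have /edgesP[v [w [vR wR evw EA]]] := sub A AT'.
  move: vR wR; rewrite !inE => /and3P[_ _ vR] /and3P[_ _ wR].
  by apply/edgesP; exists v, w.
- move=> A B; rewrite !inE => /orP[/eqP->|AT'] /orP[/eqP->|BT'] x //.
  + rewrite !inE => xtu /(T'R _ _ BT')[xu xt _].
    by rewrite (negPf xu) (negPf xt) in xtu.
  + move=> /(T'R _ _ AT')[xu xt _]; rewrite !inE.
    by rewrite (negPf xu) (negPf xt).
  exact: triv.
move=> x xR; case: (boolP (x \in [fset t; u])) => xtu.
  by exists [fset t; u] => //; rewrite fset1U1.
have [|A AT' xA] := cov x; last by exists A => //; rewrite !inE AT' orbT.
by move: xtu; rewrite !inE xR andbT negb_or andbC.
Qed.

Lemma card_matchings_through e R t u : e t u -> t != u -> t \in R -> u \in R ->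
  #|` [fset T in matchings e R | [fset t; u] \in T]| = nmatch e (R `\ t `\ u).
Proof.
move=> etu tu tR uR; rewrite matchings_through // card_in_imfset //=.
have notin T : T \in matchings e (R `\ t `\ u) -> [fset t; u] \notin T.
  move=> /matchingsP[sub _ _]; apply/negP => /sub/edgesP[v [w [+ _ _ E]]].
  rewrite !inE => /and3P[vu vt _]; have : v \in [fset t; u].
    by rewrite E !inE eqxx.
  by rewrite !inE (negPf vu) (negPf vt).
move=> T T' /notin nT /notin nT' E.
apply/fsetP => A; have /fsetP/(_ A) := E; rewrite !inE.
by case: eqP => // ->; rewrite (negPf nT) (negPf nT').
Qed.

(** Double counting of the pairs [(u, T)] with [[fset t; u]] in [T]: a matching covers [t] by
    exactly one edge. *)
Lemma nmatch_expand e R t : symmetric e -> irreflexive e -> t \in R ->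
  nmatch e R = \sum_(u <- R | e t u) nmatch e (R `\ t `\ u).
Proof.
move=> sym irr tR; rewrite big_seq_cond.
have tu u : e t u -> t != u by apply: contraTneq => ->; rewrite irr.
under eq_bigr => u /andP[uR etu] do rewrite -card_matchings_through ?tu //.
rewrite -big_seq_cond.
have -> : \sum_(u <- R | e t u) #|` [fset T in matchings e R | [fset t; u] \in T]|
   = \sum_(u <- R | e t u) \sum_(T <- matchings e R | [fset t; u] \in T) 1.
  by apply: eq_bigr => u _; rewrite card_fset_sum1 big_fset /=.
rewrite (exchange_big_dep xpredT) //= /nmatch card_fset_sum1.
rewrite big_seq [RHS]big_seq; apply: eq_bigr => T /matchingsP[sub triv cov].
have [A AT tA] := cov t tR.
have [v [vR etv EA]] : exists v, [/\ v \in R, e t v & A = [fset t; v]].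
  have /edgesP[v [w [vR wR evw EA]]] := sub A AT.
  move: tA; rewrite EA !inE => /orP[/eqP->|/eqP->]; first by exists w.
  by exists v; rewrite sym evw fsetUC.
rewrite big_mkcond (big_fsetD1 v) //= etv -EA AT /= big_seq big1 ?addn0 // => u.
rewrite !inE => /andP[uv uR]; case: ifP => // /andP[etu tuT].
have Etu : [fset t; u] = A by apply: (triv _ _ tuT AT t) => //; rewrite !inE eqxx.
by move: uv; rewrite EA in Etu; rewrite (fset2_inj Etu) eqxx.
Qed.

Lemma nmatch_expand_seq e R t (N : seq K) : symmetric e -> irreflexive e ->
    t \in R -> uniq N -> (forall u, (u \in N) = (u \in R) && e t u) ->
  nmatch e R = \sum_(u <- N) nmatch e (R `\ t `\ u).
Proof.
move=> sym irr tR uN NE; rewrite (nmatch_expand sym irr tR) -big_filter.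
apply: perm_big; apply: uniq_perm => //; first by rewrite filter_uniq ?fset_uniq.
by move=> u; rewrite mem_filter NE andbC.
Qed.

Lemma eq_in_nmatch e e' R :
  {in R &, e =2 e'} -> nmatch e R = nmatch e' R.
Proof.
move=> ee'; rewrite /nmatch /matchings; suff -> : edges e R = edges e' R by [].
apply/fsetP => A; apply/edgesP/edgesP => -[t [u [tR uR etu ->]]];
  by exists t, u; split=> //; rewrite ?ee' // -ee'.
Qed.

(** Induction on the size of [R1]: expand at a vertex of [R1], whose neighbours all lie in [R1]. *)
Lemma nmatch_disjoint e R1 R2 : symmetric e -> irreflexive e ->
    {in R1 & R2, forall t u, (t != u) && ~~ e t u} ->
  nmatch e (R1 `|` R2) = nmatch e R1 * nmatch e R2.
Proof.
move=> sym irr; move: {2}(#|` R1|) (leqnn #|` R1|) => n.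
elim: n R1 => [|n IHn] R1.
  by rewrite leqn0 cardfs_eq0 => /eqP-> _; rewrite fset0U nmatch0 mul1n.
move=> leR1 sep; have [->|[t tR1]] := fset_0Vmem R1.
  by rewrite fset0U nmatch0 mul1n.
set N := [seq u <- enum_fset R1 | e t u].
have uN : uniq N by rewrite filter_uniq ?fset_uniq.
have NE u : (u \in N) = (u \in R1) && e t u by rewrite mem_filter andbC.
have tU : t \in R1 `|` R2 by rewrite inE tR1.
have NE' u : (u \in N) = (u \in R1 `|` R2) && e t u.
  rewrite NE inE; case: (boolP (u \in R1)) => //= _.
  case: (boolP (u \in R2)) => //= uR2.
  by have /andP[_ /negPf->] := sep t u tR1 uR2.
rewrite (nmatch_expand_seq sym irr tU uN NE').
rewrite (nmatch_expand_seq sym irr tR1 uN NE) big_distrl /=.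
rewrite !big_seq; apply: eq_bigr => u; rewrite NE => /andP[uR1 etu].
rewrite -IHn.
- congr nmatch; apply/fsetP => x; rewrite !inE.
  case: (boolP (x \in R2)) => [xR2|_]; last by rewrite !orbF.
  rewrite !orbT !andbT.
  have /andP[] := sep u x uR1 xR2; have /andP[] := sep t x tR1 xR2.
  by rewrite ![x == _]eq_sym => -> _ ->.
- have := cardfsD1 t R1; rewrite tR1.
  have := fsubset_leq_card (fsubD1set (R1 `\ t) u); lia.
by move=> x y; rewrite !inE => /and3P[_ _ xR1]; apply: sep.
Qed.

(** Matchings are split by whether they use the edge from [u] to [d]. The new relation forbids it in
    both directions and so stays symmetric. *)
Lemma nmatch_delete_contract e R u d : symmetric e -> irreflexive e ->
    u \in R -> d \in R -> e u d ->
  nmatch e R =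
  nmatch [rel x y | e x y && ~~ ((x == u) && (y == d) || (x == d) && (y == u))] R
  + nmatch e (R `\ u `\ d).
Proof.
move=> sym irr uR dR eud; set e' := [rel x y | _].
have ud : u != d by apply: contraTneq eud => ->; rewrite irr.
have sym' : symmetric e'.
  move=> x y; rewrite /e' /= sym; congr (_ && ~~ _).
    by case: (x == u); case: (y == d); case: (x == d); case: (y == u).
have irr' : irreflexive e' by move=> x; rewrite /e' /= irr.
rewrite (nmatch_expand sym irr uR) (nmatch_expand sym' irr' uR).
rewrite big_mkcond (big_fsetD1 d) //= eud addnC; congr (_ + _).
rewrite [RHS]big_mkcond [RHS](big_fsetD1 d) //= !eqxx andbF /= add0n.
rewrite big_seq [RHS]big_seq; apply: eq_bigr => v; rewrite !inE => /andP[vd vR].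
rewrite (negPf vd) (negPf ud) /= andbT; case: ifP => // _.
apply: eq_in_nmatch => x y; rewrite !inE /= => /and3P[_ xu _] /and3P[_ yu _].
by rewrite (negPf xu) (negPf yu) !andbF andbT.
Qed.

Definition fset_del R (A : seq K) : {fset K} := [fset x in R | x \notin A].

Lemma in_fset_del R A x : (x \in fset_del R A) = (x \in R) && (x \notin A).
Proof. by rewrite in_fset inE. Qed.

(** The value 0 when an entry of [A] lies outside [R] lets the cut formula range over all sublists,
    even with pairs whose ends are missing. *)
Definition nmatch_del e R (A : seq K) : nat :=
  if all (mem R) A then nmatch e (fset_del R A) else 0.

Lemma nmatch_del_cons e R u A : u \in R -> u \notin A ->
  nmatch_del e R (u :: A) = nmatch_del e (R `\ u) A.
Proof.
move=> uR uA; rewrite /nmatch_del /= uR /=.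
have -> : all (mem (R `\ u)) A = all (mem R) A.
  apply: eq_in_all => x xA; rewrite !inE; case: eqP => // xu.
  by rewrite -xu xA in uA.
congr (if _ then nmatch e _ else _); apply/fsetP => x.
by rewrite !in_fset_del !inE negb_or; case: (x \in R); rewrite ?andbT ?andbF.
Qed.

Lemma eq_in_nmatch_del e e' R A :
  {in R &, e =2 e'} -> nmatch_del e R A = nmatch_del e' R A.
Proof.
move=> ee'; rewrite /nmatch_del; case: ifP => // _; apply: eq_in_nmatch.
by move=> x y; rewrite !in_fset_del => /andP[xR _] /andP[yR _]; apply: ee'.
Qed.

End Matchings.

(** * Cutting a graph along a list of edges *)

Fixpoint subseqs (T : Type) (q : seq T) : seq (seq T) :=
  if q is x :: q' then subseqs q' ++ map (cons x) (subseqs q') else [:: [::]].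

Lemma mem_subseqs (T : eqType) (q s : seq T) :
  s \in subseqs q -> {subset s <= q}.
Proof.
elim: q s => [|x q IHq] s /=; first by rewrite inE => /eqP->.
rewrite mem_cat => /orP[/IHq sq y /sq|/mapP[s' /IHq sq -> y]].
  by rewrite inE orbC => ->.
by rewrite !inE => /orP[->//|/sq->]; rewrite orbT.
Qed.

Lemma uniq_subseqs (T : eqType) (q s : seq T) :
  uniq q -> s \in subseqs q -> uniq s.
Proof.
elim: q s => [|x q IHq] s /=; first by rewrite inE => _ /eqP->.
case/andP=> xq uq; rewrite mem_cat => /orP[/IHq->//|/mapP[s' s'q ->]] /=.
by rewrite (IHq _ uq s'q) andbT; apply: contra xq; apply: mem_subseqs.
Qed.

Lemma subseqs_map (T T' : Type) (f : T -> T') (q : seq T) :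
  subseqs (map f q) = map (map f) (subseqs q).
Proof. by elim: q => //= x q ->; rewrite map_cat -!map_comp. Qed.

(** Induction on [q], deleting and contracting its first edge, with [e] general since deletion
    alters it. [S] records the crossing edges in use. *)
Lemma nmatch_cut (K : choiceType) (e : rel K) (q : seq (K * K))
    (R1 R2 : {fset K}) :
    symmetric e -> irreflexive e -> [disjoint R1 & R2] ->
    uniq (unzip1 q) -> uniq (unzip2 q) -> {in q, forall p, p.1 \in R1 -> p.2 \in R2 -> e p.1 p.2} ->
    {in R1 & R2, forall t u, e t u -> (t, u) \in q} ->
  nmatch e (R1 `|` R2) =
  \sum_(S <- subseqs q) nmatch_del e R1 (unzip1 S) * nmatch_del e R2 (unzip2 S).
Proof.
elim: q e R1 R2 => [|[u d] q IHq] e R1 R2 sym irr dis.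
  move=> _ _ _ cross /=; rewrite big_seq1 /nmatch_del /=.
  rewrite nmatch_disjoint //; last first.
    move=> t u tR1 uR2; apply/andP; split; last by apply/negP => /(cross t u tR1 uR2).
    by apply: contraTneq uR2 => <-; apply: (fdisjointP dis).
  congr (nmatch e _ * nmatch e _); apply/fsetP => x;
    by rewrite in_fset_del andbT.
move=> /= /andP[uq uniq1] /andP[dq uniq2] edge cross.
have edge' : {in q, forall p, p.1 \in R1 -> p.2 \in R2 -> e p.1 p.2}.
  by move=> p pq; apply: edge; rewrite inE pq orbT.
rewrite big_cat big_map /=.
case: (boolP ((u \in R1) && (d \in R2))) => [/andP[uR1 dR2]|nud]; last first.
  rewrite [X in _ + X]big1_seq ?addn0; last first.
    move=> S _; rewrite /nmatch_del /=; case/nandP: nud => /negPf-> //=.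
    by rewrite muln0.
  apply: IHq => // t v tR1 vR2 etv; have := cross t v tR1 vR2 etv.
  by rewrite inE => /orP[/eqP[tu vd]|//]; rewrite -tu -vd tR1 vR2 in nud.
have eud : e u d by apply: (edge (u, d)); rewrite ?inE ?eqxx.
have dR1 : d \notin R1 by rewrite fdisjoint_sym in dis; apply: (fdisjointP dis).
have uR2 : u \notin R2 by apply: (fdisjointP dis).
rewrite (nmatch_delete_contract sym irr _ _ eud) ?inE ?uR1 ?dR2 ?orbT //.
set e' := [rel x y | _].
have ud : u != d by apply: contraTneq eud => ->; rewrite irr.
(* Deleting the edge gives the sublists that avoid the first pair; removing both its ends gives
   those that contain it. *)
congr (_ + _).
  rewrite (IHq e') //; first 1 last.
  - move=> x y; rewrite /e' /= sym; congr (_ && ~~ _).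
    by case: (x == u); case: (y == d); case: (x == d); case: (y == u).
  - by move=> x; rewrite /e' /= irr.
  - move=> [t v] tvq /= tR1 vR2; rewrite (edge' _ tvq) //=.
    have tu : t != u by apply: contraNneq uq => <-; apply: (map_f fst tvq).
    have td : t != d by apply: contraNneq dR1 => <-.
    by rewrite (negPf tu) (negPf td).
  - move=> t v tR1 vR2 /andP[etv]; rewrite negb_or => /andP[tv _].
    have := cross t v tR1 vR2 etv; rewrite inE => /orP[/eqP[]tu vd|//].
    by rewrite tu vd !eqxx in tv.
  apply: eq_bigr => S _; congr (_ * _); apply: eq_in_nmatch_del => x y xR yR /=.
    have [xd yd] : x != d /\ y != d.
      by split; apply: contraNneq dR1 => <-.
    by rewrite (negPf xd) (negPf yd) !andbF andbT.
  have [xu yu] : x != u /\ y != u by split; apply: contraNneq uR2 => <-.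
  by rewrite (negPf xu) (negPf yu) !andbF andbT.
have -> : (R1 `|` R2) `\ u `\ d = (R1 `\ u) `|` (R2 `\ d).
  apply/fsetP => x; rewrite !inE; case: (eqVneq x u) => [->|xu].
    by rewrite (negPf uR2) !andbF.
  by case: (eqVneq x d) => [->|xd] /=; rewrite ?(negPf dR1).
rewrite IHq //.
- rewrite big_seq [RHS]big_seq; apply: eq_bigr => S Sq.
  rewrite !nmatch_del_cons //; [apply: contra dq|apply: contra uq];
    by case/mapP=> p pS ->; apply: map_f; apply: (mem_subseqs Sq).
- by apply: fdisjointWl (fsubD1set _ _) (fdisjointWr (fsubD1set _ _) dis).
- by move=> p pq; rewrite !inE => /andP[_ ?] /andP[_ ?]; apply: edge'.
move=> t v; rewrite !inE => /andP[tu tR1] /andP[vd vR2] etv.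
by have := cross t v tR1 vR2 etv; rewrite inE => /orP[/eqP[/eqP]|//]; rewrite (negPf tu).
Qed.

Local Open Scope ring_scope.

(** * Adjacency of unit triangles and forced lozenges *)

Definition neighbours (t : triangle) : seq triangle :=
  let: (up, (i, j)) := t in
  if up then [:: (false, (i, j)); (false, (i - 1, j)); (false, (i, j - 1))]
  else [:: (true, (i, j)); (true, (i + 1, j)); (true, (i, j + 1))].

Lemma share_edgeE t u : share_edge t u = (u \in neighbours t).
Proof.
case: t u => [[] [i j]] [[] [i' j']]; rewrite /share_edge /=;
  rewrite !inE !xpair_eqE /= ?andbT ?orbF; apply/idP/idP; lia.
Qed.

Lemma share_edge_sym : symmetric share_edge.
Proof.
move=> [[] [i j]] [[] [i' j']]; rewrite !share_edgeE !inE !xpair_eqE /=; lia.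
Qed.

Lemma share_edge_irr : irreflexive share_edge.
Proof. by move=> t; rewrite /share_edge eqxx. Qed.

Lemma M_expand (R : {fset triangle}) t : t \in R ->
  M R = (\sum_(u <- neighbours t | u \in R) M (R `\ t `\ u))%N.
Proof.
move=> tR; rewrite -big_filter.
apply: (nmatch_expand_seq share_edge_sym share_edge_irr tR).
  rewrite filter_uniq //; case: (t) => [[] [i j]] /=;
    rewrite !inE !xpair_eqE; lia.
by move=> u; rewrite mem_filter share_edgeE.
Qed.

Lemma M_forced (R : {fset triangle}) t u : t \in R -> u \in R ->
    u \in neighbours t -> {in neighbours t, forall v, v \in R -> v = u} ->
  M R = M (R `\ t `\ u).
Proof.
move=> tR uR utt only; rewrite (M_expand tR) -big_filter.
suff -> : [seq v <- neighbours t | v \in R] = [:: u] by rewrite big_seq1.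
have unb : uniq (neighbours t).
  by case: (t) => [[] [i j]] /=; rewrite !inE !xpair_eqE; lia.
apply: perm_small_eq => //; apply: uniq_perm => //; first by rewrite filter_uniq.
move=> v; rewrite mem_filter inE; apply/andP/eqP => [[vR vt]|->//].
exact: only.
Qed.

Lemma M_isolated (R : {fset triangle}) t : t \in R ->
  {in neighbours t, forall v, v \notin R} -> M R = 0%N.
Proof.
move=> tR iso; rewrite (M_expand tR) big1_seq // => u /andP[uR ut].
by have := iso u ut; rewrite uR.
Qed.

Lemma in_polygon (i0 i1 j0 j1 k0 k1 i j : int) up :
  ((up, (i, j)) \in polygon i0 i1 j0 j1 k0 k1) =
  [&& i0 <= i, i + 1 <= i1, j0 <= j, j + 1 <= j1,
      k0 <= i + j + (~~ up)%:Z & i + j + 1 + (~~ up)%:Z <= k1].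
Proof.
have in_range lo hi x : (x \in int_range lo hi) = (lo <= x < hi).
  apply/mapP/idP => [[n]|xlh]; first by rewrite mem_iota; lia.
  by exists `|x - lo|%N; rewrite ?mem_iota; lia.
rewrite /polygon in_fset inE -[X in X && _]/(_ \in allpairs _ _ _).
have -> : ((up, (i, j)) \in [seq (up0, p) | up0 <- [:: true; false],
     p <- [seq (i, j) | i <- int_range i0 i1, j <- int_range j0 j1]])
   = (i0 <= i < i1) && (j0 <= j < j1).
  rewrite -!in_range; apply/allpairsP/idP => [[[b p] /= [_ pI []]]|/andP[iI jJ]].
    by move=> _ Ep; move: pI; rewrite -Ep => /allpairsP[[i' j'] /= [? ? [-> ->]]]; apply/andP.
  exists (up, (i, j)); split=> //=; first by case: up.
  by apply/allpairsP; exists (i, j).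
by case: up => /=; lia.
Qed.

(** * Integer intervals, interlacing sequences and the transfer across one row *)

Definition irange (i : int) (n : nat) : seq int := [seq i + k%:Z | k <- iota 0 n].

Lemma mem_irange i n x : (x \in irange i n) = (i <= x < i + n%:Z).
Proof.
apply/mapP/idP => [[k]|xlh]; first by rewrite mem_iota; lia.
by exists `|x - i|%N; rewrite ?mem_iota; lia.
Qed.

Lemma irange_uniq i n : uniq (irange i n).
Proof. by rewrite map_inj_uniq ?iota_uniq // => x y; lia. Qed.

Lemma size_irange i n : size (irange i n) = n.
Proof. by rewrite size_map size_iota. Qed.

Lemma irangeD i m n : irange i (m + n) = irange i m ++ irange (i + m%:Z) n.
Proof.
rewrite /irange iotaD map_cat; congr (_ ++ _); rewrite add0n.
rewrite -[X in iota X _]addn0 iotaDl -map_comp; apply: eq_map => k /=; lia.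
Qed.

Lemma irangeS i n : irange i n.+1 = i :: irange (i + 1) n.
Proof. by rewrite -add1n irangeD /= addr0. Qed.

(* The sequences [:: x_0; ...; x_(r-1)] interlacing with [:: d_0; ...; d_r],
   that is d_k <= x_k < d_(k+1). *)
Fixpoint interlacing (d : seq int) : seq (seq int) :=
  match d with
  | [::] => [::]
  | d0 :: d' =>
      if d' is d1 :: _ then
        [seq x :: s | x <- irange d0 `|d1 - d0|%N, s <- interlacing d']
      else [:: [::]]
  end.

Lemma interlacing_cons2 d0 d1 d :
  interlacing [:: d0, d1 & d] =
  [seq x :: s | x <- irange d0 `|d1 - d0|%N, s <- interlacing (d1 :: d)].
Proof. by []. Qed.

Lemma interlacingP d s : sorted <%R d -> s \in interlacing d ->
  [/\ size d = (size s).+1, sorted <%R s,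
      forall lo, {in d, forall x, lo <= x} -> {in s, forall x, lo <= x} &
      forall hi, {in d, forall x, x <= hi} -> {in s, forall x, x < hi}].
Proof.
elim: d s => [|d0 [|d1 d] IHd] s //.
  by rewrite /= inE => _ /eqP->; split.
move=> /= /andP[d01 sd]; rewrite -/(interlacing (d1 :: d)).
move=> /allpairsP[[x s'] /= [xI s'I ->]].
have [szd ss' los' his'] := IHd _ sd s'I.
have d1min y : y \in s' -> d1 <= y.
  apply: los' => {}y; rewrite inE => /orP[/eqP->//|yd]; apply: ltW.
  by have /allP/(_ y yd) := order_path_min lt_trans sd.
rewrite mem_irange in xI; split.
- by rewrite /= -szd.
- rewrite /= path_sortedE; last exact: lt_trans.
  by rewrite ss' andbT; apply/allP => y /d1min; lia.
- move=> lo bd y; rewrite inE => /orP[/eqP->|/d1min].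
    by have := bd d0; rewrite inE eqxx => /(_ isT); lia.
  by have := bd d0; rewrite inE eqxx => /(_ isT); lia.
move=> hi bd y; rewrite inE => /orP[/eqP->|].
  by have := bd d1; rewrite !inE eqxx orbT => /(_ isT); lia.
by apply: his' => {}y yd; apply: bd; rewrite inE yd orbT.
Qed.

Definition tri_row (up : bool) (j : int) (p : seq int) : seq triangle :=
  [seq (up, (i, j)) | i <- p].

Lemma mem_tri_row up j p up' i j' :
  ((up', (i, j')) \in tri_row up j p) = [&& up' == up, j' == j & i \in p].
Proof.
apply/mapP/idP => [[k kp [-> -> ->]]|/and3P[/eqP-> /eqP-> ip]]; last by exists i.
by rewrite !eqxx.
Qed.

Definition M_del (R : {fset triangle}) (A : seq triangle) : nat :=
  nmatch_del share_edge R A.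

Lemma M_del_nil R : M_del R [::] = M R.
Proof.
rewrite /M_del /nmatch_del /=; congr nmatch.
by apply/fsetP => x; rewrite in_fset_del andbT.
Qed.

(* The row is scanned from left to right: the leftmost remaining triangle either
   has a single partner or is a down-pointing triangle that is matched to the
   right or upwards, the second alternative contributing an element of [s]. *)
Lemma M_row_transfer (j : int) n (lo : int) (d : seq int)
    (R U : {fset triangle}) :
    sorted <%R d -> {in d, forall x, lo <= x <= lo + n%:Z} ->
    (forall up i j', (up, (i, j')) \in U -> j < j') ->
    (forall up i j', ((up, (i, j')) \in R) =
      if j' == j then (if up then (lo <= i <= lo + n%:Z) && (i \notin d)
                       else lo <= i < lo + n%:Z)
      else (up, (i, j')) \in U) ->
  M R = (\sum_(s <- interlacing d) M_del U (tri_row true (j + 1) s))%N.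
Proof.
elim: n lo d R U => [|n IHn] lo d R U sd bd Uj RE.
  have Uj0 up i j' : j' <= j -> ((up, (i, j')) \in U) = false.
    by move=> lej; apply/negP => /Uj; lia.
  case: d sd bd RE => [|d0 d] sd bd RE.
    (* Only the up-pointing triangle at [lo] remains in the row, without a partner; accordingly
       [interlacing [::]] is empty. *)
    rewrite big_nil; apply: (@M_isolated _ (true, (lo, j))).
      by rewrite RE eqxx in_nil andbT; lia.
    move=> v; rewrite !inE => /or3P[]/eqP->; rewrite RE ?eqxx; [lia|lia|].
    by rewrite Uj0; [case: eqP|]; lia.
  have Ed0 : d0 = lo by have := bd d0; rewrite inE eqxx => /(_ isT); lia.
  have -> : d = [::].
    case: d sd bd {RE} => // d1 d /= /andP[d01 _] bd.
    by have := bd d1; rewrite !inE eqxx orbT => /(_ isT); lia.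
  rewrite /= big_seq1 /= M_del_nil; congr M; apply/fsetP => -[up [i j']].
  rewrite RE; case: eqP => // ->; rewrite Uj0 //; case: up; last lia.
  by rewrite inE; lia.
have Uj0 up i j' : j' <= j -> ((up, (i, j')) \in U) = false.
  by move=> lej; apply/negP => /Uj; lia.
have downlo : (false, (lo, j)) \in R by rewrite RE eqxx; lia.
have jj1 : (j + 1 == j) = false by lia.
(* If [lo] is not a dent, the up-pointing triangle there is forced onto the down-pointing one to its
   right, and the scan moves on with the same [d]. *)
case: (boolP (lo \in d)) => lod; last first.
  have bd' : {in d, forall x, lo + 1 <= x <= lo + 1 + n%:Z}.
    move=> x xd; have := bd x xd; suff : x != lo by lia.
    by apply: contraNneq lod => <-.
  have uplo : (true, (lo, j)) \in R by rewrite RE eqxx lod; lia.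
  rewrite (M_forced uplo downlo) ?inE ?eqxx //; last first.
    move=> v; rewrite !inE => /or3P[]/eqP-> //; rewrite RE ?eqxx; first lia.
    by rewrite Uj0; [case: eqP|]; lia.
  apply: (IHn (lo + 1) d) => // up i j'; rewrite !inE RE !xpair_eqE.
  case: (eqVneq j' j) => [_|_]; last by rewrite !andbF.
  case: up => /=; last lia.
  by case: (eqVneq i lo) => [->|]; case: (i \in d) => /=; lia.
case: d lod sd bd RE => // d0 d lod sd bd RE.
have dmin x : x \in d -> d0 < x.
  by move=> xd; have /allP/(_ x xd) := order_path_min lt_trans sd.
have Ed0 : d0 = lo.
  move: lod; rewrite inE => /orP[/eqP//|/dmin].
  by have := bd d0; rewrite inE eqxx => /(_ isT); lia.
subst d0; have {}sd' : sorted <%R d by apply: path_sorted sd.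
have bd' : {in d, forall x, lo + 1 <= x <= lo + 1 + n%:Z}.
  move=> x xd; have := dmin x xd; have := bd x; rewrite inE xd orbT.
  by move=> /(_ isT); lia.
have up0 : ((true, (lo, j)) \in R) = false by rewrite RE eqxx mem_head andbF.
have up1 : ((true, (lo + 1, j)) \in R) = (lo + 1 \notin d).
  by rewrite RE eqxx inE; case: (lo + 1 \in d); lia.
have up2 : ((true, (lo, j + 1)) \in R) = ((true, (lo, j + 1)) \in U).
  by rewrite RE jj1.
rewrite (M_expand downlo) [neighbours _]/= !big_cons big_nil up0 up1 up2.
have second : ((if (true, (lo, (j + 1)%R)) \in U
      then M (R `\ (false, (lo, j)) `\ (true, (lo, (j + 1)%R))) else 0) =
   \sum_(s <- interlacing d) M_del U (tri_row true (j + 1) (lo :: s)))%N.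
  case: ifPn => upU; last first.
    by rewrite big1 // => s _; rewrite /M_del /nmatch_del /= (negPf upU).
  rewrite (IHn (lo + 1) d _ (U `\ (true, (lo, j + 1)))) //.
  - rewrite big_seq [RHS]big_seq; apply: eq_bigr => s sI.
    rewrite /M_del /= nmatch_del_cons //.
    rewrite mem_tri_row !eqxx /=; apply/negP => los.
    have [_ _ los_ _] := interlacingP sd' sI.
    suff : lo + 1 <= lo by lia.
    by apply: los_ los => x /bd'; lia.
  - by move=> up i j'; rewrite in_fsetD1 => /andP[_]; apply: Uj.
  move=> up i j'; rewrite !inE RE !xpair_eqE.
  case: (eqVneq j' j) => [->|_] /=; last by rewrite !andbF.
  rewrite [j == j + 1]eq_sym jj1 !andbF /= inE.
  case: up => /=; last lia.
  by case: (eqVneq i lo) => [->|] /=; case: (i \in d); lia.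
(* Matching to the right removes the up-pointing triangle at [lo + 1], so the dent at [lo] moves
   there, provided [lo + 1] is not a dent yet. *)
have first : lo + 1 \notin d ->
   M (R `\ (false, (lo, j)) `\ (true, (lo + 1, j))) =
   (\sum_(s <- interlacing ((lo + 1)%R :: d)) M_del U (tri_row true (j + 1) s))%N.
  move=> lo1d; apply: (IHn (lo + 1)) => //.
  - rewrite /= path_sortedE ?sd' ?andbT; last exact: lt_trans.
    apply/allP => x xd; have := dmin x xd.
    by case: (eqVneq x (lo + 1)) => [xE|]; [rewrite -xE xd in lo1d|lia].
  - by move=> x; rewrite inE => /orP[/eqP->|/bd'//]; lia.
  move=> up i j'; rewrite !inE RE !xpair_eqE inE.
  case: (eqVneq j' j) => [_|_] /=; last by rewrite !andbF.
  case: up => /=; last lia.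
  by case: (eqVneq i lo) => [->|] /=; case: (i \in d); lia.
have -> : forall (b : bool) m n', (if (lo + 1)%R \notin d
      then m + (if b then n' + 0 else 0) else if b then n' + 0 else 0)%N =
    ((if (lo + 1)%R \notin d then m else 0) + (if b then n' else 0))%N.
  by move=> b m n'; rewrite addn0; case: ifP.
rewrite second; case: d sd bd RE lod dmin sd' bd' up1 second first => [|d1 d].
  move=> _ _ _ _ _ _ _ _ _ /(_ isT) first.
  by rewrite first /= !big_nil !big_seq1 addn0.
move=> _ _ _ _ dmin sd' bd' _ _ first.
have lod1 : lo < d1 by apply: dmin; rewrite inE eqxx.
have E : irange lo `|d1 - lo|%N = lo :: irange (lo + 1) `|d1 - (lo + 1)%R|%N.
  by rewrite -irangeS; congr irange; lia.
rewrite interlacing_cons2 E allpairs_cons big_cat big_map [RHS]addnC.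
congr (_ + _)%N; case: (eqVneq d1 (lo + 1)) => [->|nd1].
  by rewrite subrr /= big_nil mem_head.
have lo1d : lo + 1 \notin d1 :: d.
  rewrite inE negb_or eq_sym nd1 /=; apply/negP => lo1d.
  have /allP/(_ _ lo1d) := order_path_min lt_trans sd'; lia.
by rewrite lo1d first.
Qed.

(** * Summation over interlacing sequences by determinants *)

Section Determinants.

(** The binomial coefficient as a polynomial in [x], so that negative [x] are allowed. *)
Definition binr (x : int) (j : nat) : rat :=
  (\prod_(k < j) (x - k%:Z)%:~R) / (j`!)%:R.

Lemma binr0 x : binr x 0 = 1.
Proof. by rewrite /binr big_ord0 fact0 divr1. Qed.

Lemma binr_pascal x j : binr (x + 1) j.+1 - binr x j.+1 = binr x j.
Proof.
rewrite /binr [in X in X - _]big_ord_recl big_ord_recr /= subr0.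
have -> : \prod_(i < j) (x + 1 - (bump 0 i)%:Z)%:~R = \prod_(i < j) (x - i%:Z)%:~R :> rat.
  by apply: eq_bigr => i _; rewrite /bump /= add1n; congr (_ %:~R); lia.
have jn : j.+1%:R != 0 :> rat by rewrite pnatr_eq0.
have fn : (j`!)%:R != 0 :> rat by rewrite pnatr_eq0 -lt0n fact_gt0.
rewrite factS natrM rmorphD rmorphB /= -[j.+1]addn1 natrD in jn *.
have -> : (j : int)%:~R = j%:R :> rat by [].
by field; rewrite fn jn.
Qed.

Lemma sum_binr d0 d1 j : d0 <= d1 ->
  \sum_(x <- irange d0 `|d1 - d0|%N) binr x j = binr d1 j.+1 - binr d0 j.+1.
Proof.
move=> led; have Ed1 : d1 = d0 + `|d1 - d0|%N%:Z by lia.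
rewrite {2}Ed1; elim: `|d1 - d0|%N => [|n IHn]; first by rewrite big_nil addr0 subrr.
rewrite -addn1 irangeD big_cat /= IHn big_seq1 addr0 PoszD addrA.
by rewrite -(binr_pascal (d0 + n%:Z) j); ring.
Qed.

(** A matrix is a list of rows, each a function of the column index, so that a sum over one entry of
    a sequence acts on one row. *)
Definition detl n (rows : seq (nat -> rat)) : rat :=
  \det (\matrix_(i < n, j < n) nth (fun=> 0) rows i j).

Lemma eq_detl n r1 r2 :
  (forall i j, (i < n)%N -> nth (fun=> 0) r1 i j = nth (fun=> 0) r2 i j) ->
  detl n r1 = detl n r2.
Proof. by move=> E; congr (\det _); apply/matrixP => i j; rewrite !mxE E. Qed.

Lemma detl_sum n (pre post : seq (nat -> rat)) (I : Type) (r : seq I)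
    (f : I -> nat -> rat) : (size pre < n)%N ->
  detl n (pre ++ (fun j => \sum_(x <- r) f x j) :: post) =
  \sum_(x <- r) detl n (pre ++ f x :: post).
Proof.
move=> ltn; pose i0 : 'I_n := Ordinal ltn.
have lin f1 f2 f3 (b c : rat) : (forall j, f1 j = b * f2 j + c * f3 j) ->
    detl n (pre ++ f1 :: post) =
    b * detl n (pre ++ f2 :: post) + c * detl n (pre ++ f3 :: post).
  move=> E; rewrite /detl.
  have off (g h : nat -> rat) : row' i0 (\matrix_(i < n, j < n)
      nth (fun=> 0) (pre ++ g :: post) i j) = row' i0 (\matrix_(i < n, j < n)
      nth (fun=> 0) (pre ++ h :: post) i j).
    apply/matrixP => i j; rewrite !mxE !nth_cat.
    case: ltnP => //= le; have : lift i0 i != i0 by rewrite eq_sym neq_lift.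
    rewrite -val_eqE /= => ne.
    have : (0 < bump (size pre) i - size pre)%N by lia.
    by case: (_ - _)%N.
  apply: (determinant_multilinear (i0 := i0)) => //.
  by apply/rowP => j; rewrite !mxE !nth_cat ltnn subnn /=.
elim: r => [|x r IHr].
  rewrite big_nil (@lin _ (fun=> 0) (fun=> 0) 0 0); first by rewrite !mul0r addr0.
  by move=> j; rewrite big_nil !mul0r addr0.
rewrite big_cons -IHr (@lin _ (f x) (fun j => \sum_(x <- r) f x j) 1 1).
  by rewrite !mul1r.
by move=> j; rewrite big_cons !mul1r.
Qed.

Fixpoint binr_diffs (d : seq int) : seq (nat -> rat) :=
  if d is d0 :: d' then
    if d' is d1 :: _ then
      (fun j => binr d1 j.+1 - binr d0 j.+1) :: binr_diffs d'
    else [::]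
  else [::].

(** The entries of an interlacing sequence range over independent intervals, so by multilinearity
    each row is summed on its own, and the sum telescopes. [pre] holds the rows of the entries
    already fixed. *)
Lemma sum_interlacing_detl n (pre : seq (nat -> rat)) (d : seq int) :
    sorted <%R d -> d != [::] -> (size pre + (size d).-1 = n)%N ->
  \sum_(s <- interlacing d) detl n (pre ++ map binr s) =
  detl n (pre ++ binr_diffs d).
Proof.
elim: d pre => [|d0 [|d1 d] IHd] pre //; first by rewrite /= big_seq1.
move=> /= /andP[d01 sd] _ szn.
rewrite -/(interlacing (d1 :: d)) big_allpairs_dep.
rewrite -(@eq_detl _ (pre ++ (fun j => \sum_(x <- irange d0 `|d1 - d0|%N) binr x j)
   :: binr_diffs (d1 :: d))); last first.
  move=> i j _; rewrite !nth_cat; case: ifP => // _.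
  by case: (i - size pre)%N => //=; rewrite sum_binr // ltW.
rewrite detl_sum; last lia.
apply: eq_bigr => x _; rewrite -cat_rcons -IHd //; last by rewrite size_rcons /=; lia.
by apply: eq_bigr => s _; rewrite cat_rcons.
Qed.

Lemma nth_binr_diffs d i j : (i.+1 < size d)%N ->
  nth (fun=> 0) (binr_diffs d) i j = binr (nth 0 d i.+1) j.+1 - binr (nth 0 d i) j.+1.
Proof.
by elim: d i => [|d0 [|d1 d] IHd] [|i] //= H; apply: IHd.
Qed.

(** The first column consists of ones. Subtracting from each row its predecessor leaves a single
    nonzero entry there, and expanding along it gives the smaller determinant. *)
Lemma detl_binr_diffs n d : size d = n.+1 ->
  detl n (binr_diffs d) = detl n.+1 (map binr d).
Proof.
move=> szd; rewrite /detl; set A := (X in _ = \det X).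
pose L : 'M[rat]_n.+1 := \matrix_(i, j) ((i == j)%:R - (i == j.+1 :> nat)%:R).
have detL : \det L = 1.
  rewrite det_trig.
    rewrite big1 // => i _; rewrite mxE eqxx.
    by have -> : (i == i.+1 :> nat) = false by lia; rewrite subr0.
  apply/is_trig_mxP => i j ltij; rewrite mxE -val_eqE /=.
  have -> : (i == j :> nat) = false by lia.
  by have -> : (i == j.+1 :> nat) = false by lia; rewrite subrr.
rewrite -[RHS]mul1r -detL -det_mulmx (expand_det_col _ ord0).
(* Row 0 has no predecessor and is kept; [inord i.-1] is the predecessor of any other row. *)
have LA (i j : 'I_n.+1) : (L *m A) i j =
    A i j - (if i == 0%N :> nat then 0 else A (inord i.-1) j).
  rewrite mxE; under eq_bigr => k _ do rewrite mxE mulrBl.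
  rewrite big_split /= sumrN; congr (_ - _).
    rewrite (bigD1 i) //= eqxx mul1r big1 ?addr0 // => k ki.
    by rewrite eq_sym (negPf ki) mul0r.
  case: ifP => [/eqP i0|i0].
    by rewrite big1 // => k _; rewrite i0 mul0r.
  rewrite (bigD1 (inord i.-1)) //= inordK; last by have := ltn_ord i; lia.
  rewrite prednK ?eqxx ?mul1r; last by lia.
  rewrite big1 ?addr0 // => k ki; case: eqP => [E|]; last by rewrite mul0r.
  by move: ki; rewrite E /= inord_val eqxx.
rewrite (bigD1 ord0) //= big1 ?addr0 => [|i i0]; last first.
  rewrite LA; have -> : (i == 0%N :> nat) = false by apply: negbTE; move: i0; rewrite -val_eqE.
  rewrite !mxE !(nth_map 0) ?szd //; rewrite ?binr0 ?subrr ?mul0r //.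
rewrite LA eqxx subr0 mxE (nth_map 0) ?szd // binr0 mul1r /cofactor /= expr0 mul1r.
congr (\det _); apply/matrixP => i j.
rewrite !mxE nth_binr_diffs; last by rewrite szd ltnS.
have := LA (lift ord0 i) (lift ord0 j); rewrite mxE => ->.
have lti := ltn_ord i.
have lti' : (0 + i < n.+1)%N by lia.
by rewrite !mxE /= inordK // !(nth_map 0) ?szd.
Qed.

(** Comparing values instead of list positions makes this Vandermonde product independent of the
    order of [d]. *)
Definition vdm (d : seq int) : rat :=
  \prod_(x <- d) \prod_(y <- d | x < y) (y - x)%:~R.

Lemma hyperfactorial_neq0 n : (hyperfactorial n)%:R != 0 :> rat.
Proof. by rewrite pnatr_eq0 -lt0n prodn_gt0 // => i; apply: fact_gt0. Qed.

(** [binr x j] is a polynomial in [x] of degree [j] with leading coefficient 1/j!, so the matrix is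
    a Vandermonde matrix times a triangular one whose determinant is the inverse of
    [hyperfactorial n]. *)
Lemma detl_binr n d : sorted <%R d -> size d = n ->
  detl n (map binr d) = vdm d / (hyperfactorial n)%:R.
Proof.
move=> sd szd; pose p j : {poly rat} :=
  (j`!)%:R^-1 *: \prod_(k < j) ('X - (k%:R)%:P).
have szp j : size (p j) = j.+1.
  rewrite size_scale; first by rewrite size_prod_XsubC /index_enum -enumT size_enum_ord.
  by rewrite invr_eq0 pnatr_eq0 -lt0n fact_gt0.
have leadp j : (p j)`_j = (j`!)%:R^-1.
  rewrite /p coefZ; set q := \prod_(k < j) _.
  have : lead_coef q = 1 by apply/monicP; apply: monic_prod_XsubC.
  rewrite /lead_coef size_prod_XsubC /index_enum -enumT size_enum_ord /= => ->.
  by rewrite mulr1.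
have evalp x j : binr x j = (p j).[x%:~R].
  rewrite hornerZ horner_prod mulrC; congr (_ / _); apply: eq_bigr => k _.
  by rewrite hornerXsubC rmorphB.
pose a : 'rV[rat]_n := \row_i (nth 0 d i)%:~R.
pose C : 'M[rat]_n := \matrix_(j, k) (p j)`_k.
have -> : detl n (map binr d) = \det ((Vandermonde n a)^T *m C^T).
  congr (\det _); apply/matrixP => i j; rewrite !mxE (nth_map 0) ?szd //.
  rewrite evalp (@horner_coef_wide _ n) ?szp ?ltn_ord //.
  by apply: eq_bigr => k _; rewrite !mxE mulrC.
rewrite det_mulmx !det_tr det_Vandermonde det_trig; last first.
  by apply/is_trig_mxP => i j lij; rewrite mxE nth_default // szp.
congr (_ * _).
  rewrite /vdm (big_nth 0) big_mkord szd; apply: eq_bigr => i _.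
  rewrite (big_nth 0) big_mkord szd.
  by apply: eq_big => [j|j _]; rewrite ?lt_sorted_ltn_nth ?inE ?szd // !mxE rmorphB.
rewrite /hyperfactorial natr_prod -prodfV /=.
by apply: eq_bigr => i _; rewrite mxE leadp.
Qed.

(** Both sides are determinants of binomial coefficients, related by row differences. This is the
    recursion of the tiling numbers from one row to the next. *)
Lemma sum_interlacing_vdm d : sorted <%R d -> d != [::] ->
  \sum_(s <- interlacing d) vdm s / (hyperfactorial (size d).-1)%:R =
  vdm d / (hyperfactorial (size d))%:R.
Proof.
move=> sd dn; have szd : size d = (size d).-1.+1 by case: (d) dn.
rewrite -detl_binr // [X in detl X]szd -detl_binr_diffs //.
have := @sum_interlacing_detl (size d).-1 [::] d sd dn (add0n _) => /= <-.
rewrite big_seq [RHS]big_seq; apply: eq_bigr => s sI.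
have [szs ss _ _] := interlacingP sd sI.
by rewrite detl_binr // szs.
Qed.

End Determinants.

(** * Difference products of lists and of intervals *)

Lemma perm_vdm d d' : perm_eq d d' -> vdm d = vdm d'.
Proof.
by move=> dd'; rewrite /vdm (perm_big _ dd'); apply: eq_bigr => x _; apply: perm_big.
Qed.

Definition cross (d d' : seq int) : rat :=
  (\prod_(x <- d) \prod_(y <- d' | x < y) (y - x)%:~R) *
  (\prod_(x <- d') \prod_(y <- d | x < y) (y - x)%:~R).

Lemma vdm_cat d d' : vdm (d ++ d') = vdm d * vdm d' * cross d d'.
Proof.
rewrite /vdm /cross big_cat /=.
under eq_bigr => x _ do rewrite big_cat.
under [X in _ * X = _]eq_bigr => x _ do rewrite big_cat.
rewrite !big_split /=; ring.
Qed.

Lemma cross_catl d1 d2 d : cross (d1 ++ d2) d = cross d1 d * cross d2 d.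
Proof.
rewrite /cross big_cat /=.
under [X in _ * X = _]eq_bigr => x _ do rewrite big_cat.
rewrite big_split /=; ring.
Qed.

Lemma perm_cross d1 d2 d : perm_eq d1 d2 -> cross d1 d = cross d2 d.
Proof.
move=> dd; rewrite /cross (perm_big _ dd); congr (_ * _).
by apply: eq_bigr => x _; apply: perm_big.
Qed.

Definition ishift (k : int) (d : seq int) : seq int := [seq x + k | x <- d].

Lemma vdm_ishift k d : vdm (ishift k d) = vdm d.
Proof.
rewrite /vdm big_map; apply: eq_bigr => x _; rewrite big_map.
by apply: eq_big => [y|y _]; [lia|congr (_ %:~R); lia].
Qed.

Lemma cross_ishift k d d' : cross (ishift k d) (ishift k d') = cross d d'.
Proof.
rewrite /cross; congr (_ * _); rewrite big_map; apply: eq_bigr => x _;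
  rewrite big_map; by apply: eq_big => [y|y _]; [lia|congr (_ %:~R); lia].
Qed.

Lemma ishift_irange k i n : ishift k (irange i n) = irange (i + k) n.
Proof. by rewrite /ishift /irange -map_comp; apply: eq_map => x /=; lia. Qed.

Lemma vdm_irange i n : vdm (irange i n) = (hyperfactorial n)%:R.
Proof.
elim: n i => [|n IHn] i; first by rewrite /vdm big_nil /hyperfactorial big_ord0.
rewrite irangeS -cat1s vdm_cat IHn /cross !big_seq1.
have -> : vdm [:: i] = 1 by rewrite /vdm big_seq1 big_mkcond big_seq1 ltxx.
rewrite [X in _ * (_ * X)]big1_seq ?mulr1 => [|x]; last first.
  rewrite mem_irange => /andP[_ xI]; rewrite big_mkcond big_seq1.
  by case: ifP => //; lia.
rewrite mul1r /hyperfactorial big_ord_recr /= natrM; congr (_ * _).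
rewrite big_map fact_prod natr_prod big_add1 /= /index_iota subn0.
rewrite big_seq_cond [RHS]big_seq_cond.
apply: eq_big => [k|k _]; first by rewrite mem_iota; lia.
rewrite [X in X%:~R](_ : _ = k.+1%:Z) //; lia.
Qed.

(* Split the difference product of an interval of length p + g + c into those of
   its three parts. *)
Lemma cross_irange i p g c :
  cross (irange i p) (irange (i + p%:Z + g%:Z) c) *
    ((hyperfactorial (p + g))%:R * (hyperfactorial (g + c))%:R) =
  (hyperfactorial (p + g + c))%:R * (hyperfactorial g)%:R.
Proof.
(* The claim combines three adjacent pairs of intervals, of lengths [p + g] and [c], [p] and [g],
   [g] and [c]. *)
have two i' m n : cross (irange i' m) (irange (i' + m%:Z) n) *
    ((hyperfactorial m)%:R * (hyperfactorial n)%:R) = (hyperfactorial (m + n))%:R.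
  by rewrite -(vdm_irange i' (m + n)) irangeD vdm_cat !vdm_irange mulrC.
have := two i (p + g)%N c; have := two i p g; have := two (i + p%:Z) g c.
rewrite irangeD cross_catl PoszD addrA => <- <- <-.
by ring.
Qed.

(** * Trapezoids with unit dents on the base *)

Lemma eq_M_del R A B : A =i B -> M_del R A = M_del R B.
Proof.
move=> AB; rewrite /M_del /nmatch_del (eq_all_r AB).
congr (if _ then nmatch _ _ else _).
by apply/fsetP => x; rewrite !in_fset_del AB.
Qed.

Lemma eq_tri_row up j p p' : p =i p' -> tri_row up j p =i tri_row up j p'.
Proof. by move=> pp' [up' [i j']]; rewrite !mem_tri_row pp'. Qed.

Definition trapezoid (i0 l : int) (W n : nat) : {fset triangle} :=
  polygon i0 (i0 + W%:Z) l (l + n%:Z) (i0 + l) (i0 + l + W%:Z).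

Lemma in_trapezoid i0 l W n up i j :
  ((up, (i, j)) \in trapezoid i0 l W n) =
  [&& i0 <= i, l <= j, j < l + n%:Z & i + j + 1 + (~~ up)%:Z <= i0 + l + W%:Z].
Proof. by rewrite in_polygon; case: up => /=; lia. Qed.

(** Induction on the height: the dents of the next row interlace with [d] by [M_row_transfer], and
    [sum_interlacing_vdm] evaluates the sum. Each row lowers the number of dents by one, so exactly
    [n] are needed. *)
Lemma M_del_trapezoid_sorted i0 l W n d : (n <= W)%N -> sorted <%R d ->
    {in d, forall x, i0 <= x < i0 + W%:Z} ->
  (M_del (trapezoid i0 l W n) (tri_row true l d))%:R =
  if size d == n then vdm d / (hyperfactorial n)%:R else 0.
Proof.
elim: n l W d => [|n IHn] l W d leW sd bd.
  case: d sd bd => [|d0 d] sd bd.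
    rewrite /= /vdm big_nil /hyperfactorial big_ord0 M_del_nil.
    suff -> : trapezoid i0 l W 0 = fset0.
      by rewrite [M _](nmatch0 share_edge) divr1.
    by apply/fsetP => -[up [i j]]; rewrite in_trapezoid inE; lia.
  by rewrite /M_del /nmatch_del /= in_trapezoid addr0 lt_irreflexive !andbF.
case: W leW bd => // W leW bd.
have -> : M_del (trapezoid i0 l W.+1 n.+1) (tri_row true l d) =
    (\sum_(s <- interlacing d) M_del (trapezoid i0 (l + 1) W n) (tri_row true (l + 1) s))%N.
  rewrite {1}/M_del /nmatch_del ifT; last first.
    by apply/allP => _ /mapP[x /bd xd ->]; rewrite /= in_trapezoid /=; lia.
  (* The lowest row has [W.+1] up-pointing but only [W] down-pointing triangles. *)
  apply: (M_row_transfer (lo := i0) (n := W)) => //.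
  - by move=> x /bd; lia.
  - by move=> up i j; rewrite in_trapezoid; lia.
  move=> up i j; rewrite in_fset_del mem_tri_row !in_trapezoid.
  by case: up; case: (i \in d); case: (eqVneq j l) => /=; lia.
rewrite natr_sum big_seq.
under eq_bigr => s sI.
  have [szs ss los his] := interlacingP sd sI.
  rewrite IHn //; last first.
    move=> x xs; rewrite (los i0) //=; last by move=> y /bd; lia.
    by apply: his xs => y /bd; lia.
  have -> : (size s == n) = (size d == n.+1) by rewrite szs.
  over.
rewrite -big_seq; case: eqP => szd; last by rewrite big1.
have dn : d != [::] by case: (d) szd.
by have := sum_interlacing_vdm sd dn; rewrite szd.
Qed.

Lemma M_del_trapezoid i0 l W n d : (n <= W)%N -> uniq d ->
    {in d, forall x, i0 <= x < i0 + W%:Z} ->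
  (M_del (trapezoid i0 l W n) (tri_row true l d))%:R =
  if size d == n then vdm d / (hyperfactorial n)%:R else 0.
Proof.
move=> leW ud bd; have pd := perm_sort <=%R d.
rewrite -(perm_vdm (permEl pd)) -(perm_size (permEl pd)).
rewrite -(eq_M_del _ (eq_tri_row _ _ (perm_mem (permEl pd)))).
apply: M_del_trapezoid_sorted => //; last by move=> x; rewrite mem_sort; apply: bd.
by rewrite lt_sorted_uniq_le sort_uniq ud sort_le_sorted.
Qed.

(** * Triangular dents of arbitrary side *)

Lemma in_up_triangle i l p up i' j' :
  ((up, (i', j')) \in up_triangle (i, l) p) =
  [&& i <= i', l <= j' & i' + j' + 1 + (~~ up)%:Z <= i + l + p%:Z].
Proof. by rewrite in_polygon; case: up => /=; lia. Qed.

Lemma in_down_triangle i l p up i' j' :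
  ((up, (i', j')) \in down_triangle (i, l) p) =
  [&& i + l <= i' + j' + (~~ up)%:Z, j' + 1 <= l & i' + 1 <= i + p%:Z].
Proof. by rewrite in_polygon; case: up => /=; lia. Qed.

(* Once the bottom row of the triangle is removed, its down-pointing triangles in
   that row can only be matched upwards. *)
Lemma M_solid_dent (X : {fset triangle}) i l p : up_triangle (i, l) p `<=` X ->
  M (X `\` up_triangle (i, l) p) = M (fset_del X (tri_row true l (irange i p))).
Proof.
elim: p l X => [|p IHp] l X sub.
  congr M; apply/fsetP => -[up [i' j']].
  by rewrite in_fset_del inE in_up_triangle mem_tri_row mem_irange; case: ((up, (i', j')) \in X); lia.
set Y := fset_del X _.
have YE up i' j' : ((up, (i', j')) \in Y) =
    ((up, (i', j')) \in X) && ~~ [&& up, j' == l & i <= i' <= i + p%:Z].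
  rewrite in_fset_del mem_tri_row mem_irange; congr (_ && ~~ _); lia.
have row k : (k <= p)%N -> M Y = M (fset_del Y
    (tri_row false l (irange i k) ++ tri_row true (l + 1) (irange i k))).
  elim: k => [_|k IHk ltk].
    by congr M; apply/fsetP => x; rewrite in_fset_del andbT.
  rewrite IHk; last exact: ltnW.
  have inX up i' j' : i <= i' -> l <= j' ->
      i' + j' + 1 + (~~ up)%:Z <= i + l + p.+1%:Z -> (up, (i', j')) \in X.
    by move=> *; apply: (fsubsetP sub); rewrite in_up_triangle; lia.
  rewrite (@M_forced _ (false, (i + k%:Z, l)) (true, (i + k%:Z, l + 1))).
  - congr M; apply/fsetP => -[up [i' j']].
    rewrite !in_fsetD1 !in_fset_del !mem_cat !mem_tri_row !mem_irange !xpair_eqE.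
    by case: ((up, (i', j')) \in Y); case: up => /=; lia.
  - rewrite in_fset_del YE mem_cat !mem_tri_row !mem_irange inX //=; lia.
  - rewrite in_fset_del YE mem_cat !mem_tri_row !mem_irange inX //=; lia.
  - by rewrite !inE eqxx !orbT.
  move=> v vn; have : [|| v == (true, (i + k%:Z, l)), v == (true, (i + k%:Z + 1, l))
      | v == (true, (i + k%:Z, l + 1))] by move: vn; rewrite !inE.
  case/or3P=> /eqP-> //; rewrite in_fset_del YE => /andP[/andP[_]]; lia.
rewrite (row p) //; set Z := fset_del Y _.
(* The forced lozenges use up the base of the triangle of side [p] one level higher, to which the
   induction hypothesis applies. *)
have -> : Z = fset_del (fset_del Y (tri_row false l (irange i p)))
                       (tri_row true (l + 1) (irange i p)).
  by apply/fsetP => x; rewrite !in_fset_del mem_cat negb_or andbA.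
rewrite -IHp.
  congr M; apply/fsetP => -[up [i' j']].
  rewrite !in_fsetD in_fset_del YE !in_up_triangle mem_tri_row mem_irange.
  by case: ((up, (i', j')) \in X); case: up => /=; lia.
apply/fsubsetP => -[up [i' j']]; rewrite in_up_triangle => T.
rewrite in_fset_del YE mem_tri_row mem_irange.
have -> /= : (up, (i', j')) \in X.
  by apply: (fsubsetP sub); rewrite in_up_triangle; lia.
by case: up T => /=; lia.
Qed.

(* A pair (i, p) stands for the triangle of side p whose horizontal side starts
   at position i of a given horizontal line. *)
Definition bases (sl : seq (int * nat)) : seq int :=
  flatten [seq irange p.1 p.2 | p <- sl].

Definition in_solids (l : int) (sl : seq (int * nat)) (t : triangle) : bool :=
  has (fun p => t \in up_triangle (p.1, l) p.2) sl.

Lemma in_solids_cons l i p sl t : in_solids l ((i, p) :: sl) t =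
  (t \in up_triangle (i, l) p) || in_solids l sl t.
Proof. by []. Qed.

Definition del_solids (l : int) (X : {fset triangle}) (sl : seq (int * nat)) :
  {fset triangle} := [fset t in X | ~~ in_solids l sl t].

Lemma in_del_solids l X sl t :
  (t \in del_solids l X sl) = (t \in X) && ~~ in_solids l sl t.
Proof. by rewrite in_fset inE. Qed.

(** The first coordinate is constant in the northeast direction, so a triangle stays over its base
    and disjoint bases give disjoint triangles. *)
Lemma up_triangle_column i l p up i' j' :
  (up, (i', j')) \in up_triangle (i, l) p -> i' \in irange i p.
Proof. by rewrite in_up_triangle mem_irange; case: up => /=; lia. Qed.

Lemma in_solids_column l sl up i' j' :
  in_solids l sl (up, (i', j')) -> i' \in bases sl.
Proof.
case/hasP=> p psl /up_triangle_column i'p; apply/flattenP.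
by exists (irange p.1 p.2) => //; apply: map_f.
Qed.

Lemma M_del_solids l X sl : uniq (bases sl) ->
    {in sl, forall p, up_triangle (p.1, l) p.2 `<=` X} ->
  M (del_solids l X sl) = M (fset_del X (tri_row true l (bases sl))).
Proof.
elim: sl X => [|[i p] sl IHsl] X.
  by move=> _ _; congr M; apply/fsetP => x; rewrite in_del_solids in_fset_del.
rewrite /bases /= -/(bases sl) cat_uniq => /and3P[_ /hasPn dis ubs] sub.
have -> : del_solids l X ((i, p) :: sl) = del_solids l X sl `\` up_triangle (i, l) p.
  apply/fsetP => x; rewrite in_fsetD 2!in_del_solids in_solids_cons negb_or.
  by rewrite andbCA.
rewrite M_solid_dent; last first.
  apply/fsubsetP => -[up [i' j']] T; rewrite in_del_solids.
  have -> /= : (up, (i', j')) \in X by apply: (fsubsetP (sub (i, p) (mem_head _ _))).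
  by apply/negP => /in_solids_column/dis; rewrite (up_triangle_column T).
transitivity (M (del_solids l (fset_del X (tri_row true l (irange i p))) sl)).
  by congr M; apply/fsetP => x; rewrite in_fset_del 2!in_del_solids in_fset_del andbAC.
rewrite IHsl //.
  congr M; apply/fsetP => x; rewrite !in_fset_del /tri_row map_cat mem_cat negb_or.
  by rewrite andbA.
move=> [i1 p1] psl; apply/fsubsetP => -[up [i' j']] T; rewrite in_fset_del.
have psl' : (i1, p1) \in (i, p) :: sl by rewrite inE psl orbT.
have -> /= : (up, (i', j')) \in X by apply: (fsubsetP (sub _ psl')).
rewrite mem_tri_row.
apply/negP => /and3P[_ _]; apply/negP; apply: dis.
apply/flattenP; exists (irange i1 p1); first exact: (map_f (fun p => irange p.1 p.2) psl).
exact: up_triangle_column T.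
Qed.

Definition fits (i0 : int) (W n : nat) (sl : seq (int * nat)) : bool :=
  all (fun p => [&& i0 <= p.1, p.1 + p.2%:Z <= i0 + W%:Z & (p.2 <= n)%N]) sl.

Lemma mem_bases sl i : (i \in bases sl) = has (fun p => i \in irange p.1 p.2) sl.
Proof.
apply/flattenP/hasP => [[_ /mapP[p psl ->] ip]|[p psl ip]]; first by exists p.
by exists (irange p.1 p.2) => //; apply: map_f.
Qed.

(** By [M_del_solids] each triangular dent is equivalent to the unit dents on its base, which join
    [S]. *)
Lemma M_del_dented i0 l W n sl S : (n <= W)%N -> fits i0 W n sl ->
    uniq (bases sl ++ S) -> {in S, forall x, i0 <= x < i0 + W%:Z} ->
  (M_del (del_solids l (trapezoid i0 l W n) sl) (tri_row true l S))%:R =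
  if size (bases sl ++ S) == n then vdm (bases sl ++ S) / (hyperfactorial n)%:R
  else 0.
Proof.
move=> leW /allP fit uS bS.
rewrite -(M_del_trapezoid (i0 := i0) (W := W) l) //; last first.
  move=> x; rewrite mem_cat => /orP[|/bS//]; rewrite mem_bases.
  by case/hasP=> p /fit /= fp; rewrite mem_irange; lia.
congr (_ %:R); move: uS; rewrite cat_uniq => /and3P[ubs /hasPn dis _].
have basesT : {in tri_row true l (bases sl), forall x, x \in trapezoid i0 l W n}.
  move=> _ /mapP[x xb ->]; rewrite in_trapezoid /=; move: xb; rewrite mem_bases.
  by case/hasP=> p /fit /= fp; rewrite mem_irange; lia.
rewrite /M_del /nmatch_del; rewrite [tri_row true l (_ ++ _)]map_cat all_cat.
rewrite [all _ (map _ (bases sl))](_ : _ = true) /=; last exact/allP.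
have -> : all (mem (del_solids l (trapezoid i0 l W n) sl)) (tri_row true l S) =
          all (mem (trapezoid i0 l W n)) (tri_row true l S).
  apply: eq_in_all => _ /mapP[x xS ->] /=; rewrite in_del_solids andb_idr // => _.
  by apply/negP => /in_solids_column/(negP (dis x xS)).
case: ifP => // _.
transitivity (M (del_solids l (fset_del (trapezoid i0 l W n) (tri_row true l S)) sl)).
  by congr M; apply/fsetP => x; rewrite in_fset_del 2!in_del_solids in_fset_del andbAC.
rewrite M_del_solids //.
  by congr M; apply/fsetP => x; rewrite 3!in_fset_del mem_cat negb_or andbAC -andbA.
move=> p psl; apply/fsubsetP => -[up [i j]] T; rewrite in_fset_del mem_tri_row.
rewrite in_trapezoid; have /= := fit p psl; move: (T); rewrite in_up_triangle => T' F.
have -> /= : [&& i0 <= i, l <= j, j < l + n%:Z & i + j + 1 + (~~ up)%:Z <= i0 + l + W%:Z].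
  by case: (up) T' => /=; lia.
apply/negP => /and3P[_ _ /dis/negP[]]; rewrite mem_bases; apply/hasP; exists p => //.
exact: up_triangle_column T.
Qed.

(** * Reflection and the cut along a horizontal line *)

Lemma nmatch_imfset (K : choiceType) (e : rel K) (f : K -> K) (R : {fset K}) :
    symmetric e -> irreflexive e -> injective f ->
    (forall x y, e (f x) (f y) = e x y) ->
  nmatch e (f @` R) = nmatch e R.
Proof.
move=> sym irr finj fe; have [n] := ubnP #|` R|; elim: n R => // n IHn R ltR.
have [->|[t tR]] := fset_0Vmem R; first by rewrite imfset0.
set N := [seq u <- enum_fset R | e t u].
have uN : uniq N by rewrite filter_uniq ?fset_uniq.
have NE u : (u \in N) = (u \in R) && e t u by rewrite mem_filter andbC.
have ftR : f t \in f @` R by rewrite mem_imfset.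
rewrite (nmatch_expand_seq sym irr tR uN NE).
rewrite (nmatch_expand_seq (N := map f N) sym irr ftR) ?map_inj_uniq //; last first.
  move=> u; apply/mapP/andP => [[v + ->]|[/imfsetP[v /= vR ->]]].
    by rewrite NE mem_imfset //= fe => /andP[].
  by rewrite fe => etv; exists v => //; rewrite NE vR.
rewrite big_map big_seq [RHS]big_seq; apply: eq_bigr => u; rewrite NE => /andP[uR etu].
rewrite -[RHS]IHn; last first.
  have := cardfsD1 t R; rewrite tR.
  by have := fsubset_leq_card (fsubD1set (R `\ t) u); lia.
congr nmatch; apply/fsetP => x; rewrite !in_fsetD1; apply/and3P/imfsetP.
  case=> xu xt /imfsetP[y /= yR Ex]; exists y => //=; rewrite !inE yR andbT.
  by rewrite Ex !inj_eq // in xu xt; rewrite xu xt.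
case=> y /=; rewrite !inE => /and3P[yu yt yR] ->.
by rewrite !inj_eq // mem_imfset.
Qed.

(* The reflection in the horizontal line at level l; the edge of this line
   starting at position i is fixed. *)
Definition reflect_tri (l : int) (t : triangle) : triangle :=
  let: (up, (i, j)) := t in (~~ up, (i + j - l + (~~ up)%:Z, 2 * l - 1 - j)).

Lemma reflect_triK l : involutive (reflect_tri l).
Proof.
by move=> [up [i j]]; rewrite /reflect_tri negbK; congr (_, (_, _)); case: up => /=; lia.
Qed.

Lemma share_edge_reflect l t u :
  share_edge (reflect_tri l t) (reflect_tri l u) = share_edge t u.
Proof.
case: t u => [[] [i j]] [[] [i' j']]; rewrite !share_edgeE !inE !xpair_eqE /=; lia.
Qed.

Lemma M_del_reflect l (R R' : {fset triangle}) S :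
    (forall t, (t \in R) = (reflect_tri l t \in R')) ->
  M_del R (tri_row false (l - 1) S) = M_del R' (tri_row true l S).
Proof.
move=> RR'; pose f := reflect_tri l.
have finj : injective f := can_inj (reflect_triK l).
have RE X Y : (forall t, (t \in X) = (f t \in Y)) -> X = f @` Y.
  move=> XY; apply/fsetP => t; rewrite XY -{2}[t](reflect_triK l) -/(f _).
  by rewrite mem_imfset.
have fS i : f (false, (i, l - 1)) = (true, (i, l)).
  by rewrite /f /reflect_tri; congr (_, (_, _)); lia.
rewrite /M_del /nmatch_del.
have -> : all (mem R) (tri_row false (l - 1) S) = all (mem R') (tri_row true l S).
  rewrite !all_map; apply: eq_all => i /=.
  by rewrite RR' -/(f _) fS.
case: ifP => // _; rewrite -[RHS](nmatch_imfset (f := f) _ share_edge_sym share_edge_irr) //.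
  congr nmatch; apply: RE => -[up [i j]].
  rewrite !in_fset_del RR' -/(f _); congr (_ && ~~ _).
  rewrite /f /reflect_tri !mem_tri_row.
  case: up => //=; case: (eqVneq j (l - 1)) => [->|jl] /=.
    have -> : 2 * l - 1 - (l - 1) == l by lia.
    by congr (_ \in S); lia.
  by have -> : (2 * l - 1 - j == l) = false by lia.
exact: share_edge_reflect.
Qed.

Lemma in_solids_base l sl i : i \in bases sl -> in_solids l sl (true, (i, l)).
Proof.
rewrite mem_bases => /hasP[p psl]; rewrite mem_irange => ip.
by apply/hasP; exists p => //; rewrite in_up_triangle /=; lia.
Qed.

(** [vdm S] is squared because [S] gives dents of both halves; [fixed] gathers the other dents of
    the two halves. *)
Definition crossing_sum (z : nat) (q fixed : seq int) : rat :=
  \sum_(S <- subseqs q | size S == z) vdm S ^+ 2 * cross fixed S.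

Lemma perm_crossing_sum z q f1 f2 :
  perm_eq f1 f2 -> crossing_sum z q f1 = crossing_sum z q f2.
Proof. by move=> ff; apply: eq_bigr => S _; rewrite (perm_cross _ ff). Qed.

Lemma crossing_sum_ishift k z q f :
  crossing_sum z (ishift k q) (ishift k f) = crossing_sum z q f.
Proof.
rewrite /crossing_sum /ishift subseqs_map big_map.
apply: eq_big => [S|S _]; first by rewrite size_map.
by rewrite -/(ishift _ _) -/(ishift _ _) vdm_ishift cross_ishift.
Qed.

(* Cutting along the line at level l: the lozenges crossing it occupy a set S of
   positions in q, and both halves become trapezoids with dents. *)
Lemma M_cut_formula (R : {fset triangle}) (l i1 i2 : int) (W1 n1 W2 n2 z : nat)
    (sl1 sl2 : seq (int * nat)) (q : seq int) :
    (forall up i j, l <= j -> ((up, (i, j)) \in R) =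
      ((up, (i, j)) \in del_solids l (trapezoid i1 l W1 n1) sl1)) ->
    (forall up i j, j < l -> ((up, (i, j)) \in R) =
      (reflect_tri l (up, (i, j)) \in del_solids l (trapezoid i2 l W2 n2) sl2)) ->
    (n1 <= W1)%N -> (n2 <= W2)%N -> fits i1 W1 n1 sl1 -> fits i2 W2 n2 sl2 ->
    uniq (bases sl1 ++ q) -> uniq (bases sl2 ++ q) ->
    {in q, forall i, (i1 <= i < i1 + W1%:Z) && (i2 <= i < i2 + W2%:Z)} ->
    (forall i, i1 <= i < i1 + W1%:Z -> i2 <= i < i2 + W2%:Z ->
       [|| i \in bases sl1, i \in bases sl2 | i \in q]) ->
    (size (bases sl1) + z = n1)%N -> (size (bases sl2) + z = n2)%N ->
  (M R)%:R = vdm (bases sl1) * vdm (bases sl2) *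
    crossing_sum z q (bases sl1 ++ bases sl2) /
    ((hyperfactorial n1)%:R * (hyperfactorial n2)%:R).
Proof.
move=> Rup Rdown le1 le2 fit1 fit2 uq1 uq2 bq cover sz1 sz2.
set T1 := del_solids l (trapezoid i1 l W1 n1) sl1.
set T2 := del_solids l (trapezoid i2 l W2 n2) sl2.
pose R2 := [fset t in R | t.2.2 < l].
have R2E t : (t \in R2) = (t \in R) && (t.2.2 < l) by rewrite in_fset inE.
have T1l up i j : (up, (i, j)) \in T1 -> l <= j.
  by rewrite in_del_solids in_trapezoid; lia.
have T2l up i j : (up, (i, j)) \in T2 -> l <= j.
  by rewrite in_del_solids in_trapezoid; lia.
have ER : R = T1 `|` R2.
  apply/fsetP => -[up [i j]]; rewrite in_fsetU R2E /=.
  case: (ltP j l) => jl; last by rewrite andbF orbF Rup.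
  rewrite andbT; case: (boolP (_ \in T1)) => // /T1l; lia.
have R2T2 t : (t \in R2) = (reflect_tri l t \in T2).
  case: t => up [i j]; rewrite R2E /=; case: (ltP j l) => jl.
    by rewrite andbT Rdown.
  by rewrite andbF; apply/esym/negP => /T2l; lia.
pose pairs := [seq ((true, (i, l)), (false, (i, l - 1))) | i <- q].
have E1 S : unzip1 [seq ((true, (i, l)), (false, (i, l - 1))) | i <- S]
    = tri_row true l S by rewrite /unzip1 -map_comp.
have E2 S : unzip2 [seq ((true, (i, l)), (false, (i, l - 1))) | i <- S]
    = tri_row false (l - 1) S by rewrite /unzip2 -map_comp.
have uq : uniq q by move: uq1; rewrite cat_uniq => /and3P[].
have -> : M R = (\sum_(S <- subseqs q)
    M_del T1 (tri_row true l S) * M_del T2 (tri_row true l S))%N.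
  rewrite [in LHS]ER [LHS](nmatch_cut (q := pairs) share_edge_sym share_edge_irr).
  - rewrite /pairs subseqs_map big_map; apply: eq_bigr => S _.
    by rewrite E1 E2 -(M_del_reflect S R2T2).
  - apply/fdisjointP => -[up [i j]] /T1l lj; rewrite R2E /=.
    by rewrite ltNge lj andbF.
  - by rewrite E1 map_inj_uniq // => x y [].
  - by rewrite E2 map_inj_uniq // => x y [].
  - move=> _ /mapP[i _ ->] _ _; rewrite share_edgeE /= !inE eqxx !orbT //.
  move=> [up [i j]] [up' [i' j']] tT1; have lj := T1l _ _ _ tT1.
  rewrite R2T2 share_edgeE => uT2.
  have j'l : j' < l by have := T2l _ _ _ uT2; lia.
  case: up tT1 => tT1; rewrite !inE !xpair_eqE; last by lia.
  move=> ne; have [Eu [Ei [Ej Ej']]] : up' = false /\ i' = i /\ j = l /\ j' = l - 1.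
    by lia.
  move: tT1 uT2; rewrite Eu Ei Ej Ej' => tT1 uT2; apply/mapP; exists i => //.
  have {}uT2 : (true, (i, l)) \in T2.
    suff <- : reflect_tri l (false, (i, l - 1)) = (true, (i, l)) by [].
    by rewrite /reflect_tri; congr (_, (_, _)); lia.
  move: tT1; rewrite in_del_solids in_trapezoid => /andP[t1 s1].
  move: uT2; rewrite in_del_solids in_trapezoid => /andP[t2 s2].
  (* At a position outside [q], the triangle on one side of the line would lie on the base of a dent
     and thus be missing. *)
  have := cover i; rewrite (negPf (contra (@in_solids_base l _ i) s1)).
  by rewrite (negPf (contra (@in_solids_base l _ i) s2)) /=; apply; lia.
rewrite natr_sum /crossing_sum mulr_sumr mulr_suml [RHS]big_mkcond /=.
rewrite big_seq [RHS]big_seq; apply: eq_bigr => S Sq.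
have subS := mem_subseqs Sq; have uS := uniq_subseqs uq Sq.
have ucat d : uniq (d ++ q) -> uniq (d ++ S).
  rewrite !cat_uniq => /and3P[-> /hasPn dis _]; rewrite uS andbT /=.
  by apply/hasPn => x /subS; apply: dis.
rewrite natrM (M_del_dented l le1 fit1 (ucat _ uq1)); last by move=> x /subS/bq/andP[].
rewrite (M_del_dented l le2 fit2 (ucat _ uq2)); last by move=> x /subS/bq/andP[].
(* Either half is balanced exactly when [S] has [z] entries. *)
rewrite !size_cat -sz1 -sz2 !eqn_add2l.
case: ifP => _; last by rewrite mul0r.
rewrite !vdm_cat cross_catl.
have h1 := hyperfactorial_neq0 (size (bases sl1) + z).
have h2 := hyperfactorial_neq0 (size (bases sl2) + z).
by field; rewrite h1 h2.
Qed.

(** * Ferns as lists of bases *)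

(* The triangles of odd rank if b, those of even rank otherwise. *)
Fixpoint fern_solids (b : bool) (i : int) (t : seq nat) : seq (int * nat) :=
  if t is p :: t' then
    (if b then [:: (i, p)] else [::]) ++ fern_solids (~~ b) (i + p%:Z) t'
  else [::].

Lemma fern_solids_cat b i t1 t2 : fern_solids b i (t1 ++ t2) =
  fern_solids b i t1 ++ fern_solids (b (+) odd (size t1)) (i + (sumn t1)%:Z) t2.
Proof.
elim: t1 b i => [|p t1 IHt] b i /=; first by rewrite addbF addr0.
by rewrite IHt catA addbN addNb PoszD addrA.
Qed.

Lemma bases_cat sl1 sl2 : bases (sl1 ++ sl2) = bases sl1 ++ bases sl2.
Proof. by rewrite /bases map_cat flatten_cat. Qed.

Lemma bases_cons i p sl : bases ((i, p) :: sl) = irange i p ++ bases sl.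
Proof. by []. Qed.

Lemma in_solids_cat l sl1 sl2 t :
  in_solids l (sl1 ++ sl2) t = in_solids l sl1 t || in_solids l sl2 t.
Proof. exact: has_cat. Qed.

Lemma bases_fern_solids_ishift b i k t :
  bases (fern_solids b (i + k) t) = ishift k (bases (fern_solids b i t)).
Proof.
elim: t b i => [|p t IHt] b i //=.
rewrite !bases_cat addrAC IHt /ishift map_cat; congr (_ ++ _); case: b => //=.
by rewrite !bases_cons map_cat -[map _ (irange _ _)]/(ishift k _) ishift_irange.
Qed.

Lemma osum_cons p t : osum (p :: t) = (p + esum t)%N.
Proof.
rewrite /osum /esum /= big_mkcond big_ord_recl [in RHS]big_mkcond.
by congr (_ + _)%N; apply: eq_bigr => i _; rewrite /= negbK.
Qed.

Lemma esum_cons p t : esum (p :: t) = osum t.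
Proof. by rewrite /osum /esum /= big_mkcond big_ord_recl [in RHS]big_mkcond. Qed.

Lemma osum_nil : osum [::] = 0%N. Proof. by rewrite /osum big_ord0. Qed.
Lemma esum_nil : esum [::] = 0%N. Proof. by rewrite /esum big_ord0. Qed.

Lemma osumDesum t : (osum t + esum t)%N = sumn t.
Proof.
elim: t => [|p t IHt]; first by rewrite osum_nil esum_nil.
by rewrite osum_cons esum_cons /=; lia.
Qed.

Lemma size_bases_fern_solids b i t :
  size (bases (fern_solids b i t)) = if b then osum t else esum t.
Proof.
elim: t b i => [|p t IHt] b i; first by rewrite osum_nil esum_nil if_same.
rewrite osum_cons esum_cons /= bases_cat size_cat IHt.
by case: b; rewrite //= bases_cons cats0 size_irange.
Qed.

(** The two parities of a fern fill its segment. Stated with counts, this yields permutations of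
    whole intervals by arithmetic. *)
Lemma count_bases_fern_solids P b i t :
  (count P (bases (fern_solids b i t)) + count P (bases (fern_solids (~~ b) i t)) =
   count P (irange i (sumn t)))%N.
Proof.
elim: t b i => [|p t IHt] b i //=.
rewrite irangeD !bases_cat !count_cat -(IHt b).
by case: b => /=; rewrite bases_cons cats0 /=; lia.
Qed.

Lemma fern_solids_range b i t (p : int * nat) : p \in fern_solids b i t ->
  (i <= p.1) && (p.1 + p.2%:Z <= i + (sumn t)%:Z).
Proof.
elim: t b i => [|q t IHt] b i //=; rewrite mem_cat => /orP[|/IHt]; last lia.
by case: b; rewrite // inE => /eqP-> /=; lia.
Qed.

Lemma leq_size_bases sl (p : int * nat) : p \in sl -> (p.2 <= size (bases sl))%N.
Proof.
elim: sl => // -[i n] sl IHsl; rewrite bases_cons size_cat size_irange inE.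
by case/orP=> [/eqP->|/IHsl] /=; lia.
Qed.

Lemma fits_bases i0 W n sl : (size (bases sl) <= n)%N ->
    {in sl, forall p, (i0 <= p.1) && (p.1 + p.2%:Z <= i0 + W%:Z)} ->
  fits i0 W n sl.
Proof.
move=> szn bsl; apply/allP => p psl; rewrite (leq_trans (leq_size_bases psl)) //.
by rewrite andbT bsl.
Qed.

Lemma in_down_triangle_reflect l i p t :
  (t \in down_triangle (i, l) p) = (reflect_tri l t \in up_triangle (i, l) p).
Proof.
case: t => up [i' j']; rewrite in_down_triangle /reflect_tri in_up_triangle.
by case: up => /=; lia.
Qed.

(** The two lists, of up-pointing and of reflected down-pointing triangles, serve the two halves in
    the cut formula. *)
Lemma in_fern_right up i l ts t :
  (t \in fern_right up (i, l) ts) =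
  in_solids l (fern_solids up i ts) t ||
  in_solids l (fern_solids (~~ up) i ts) (reflect_tri l t).
Proof.
elim: ts up i => [|p ts IHts] up i; first by rewrite inE.
rewrite [fern_right _ _ _]/= in_fsetU IHts [fern_solids _ _ (p :: ts)]/=.
rewrite [fern_solids (~~ up) i (p :: ts)]/= !in_solids_cat negbK.
by case: up => /=; rewrite orbF; [rewrite orbA | rewrite in_down_triangle_reflect orbCA].
Qed.

Lemma fern_right_cat up i l t1 t2 : fern_right up (i, l) (t1 ++ t2) =
  fern_right up (i, l) t1 `|`
  fern_right (up (+) odd (size t1)) (i + (sumn t1)%:Z, l) t2.
Proof.
elim: t1 up i => [|p t1 IHt] up i /=; first by rewrite fset0U addbF addr0.
by rewrite IHt fsetUA addbN addNb PoszD addrA.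
Qed.

(** Read from the left, the fern begins with the last entry of [t], whose orientation has been
    reversed [(size t).-1] times. *)
Lemma fern_leftE up i l t : fern_left up (i, l) t =
  fern_right (up (+) ~~ odd (size t)) (i - (sumn t)%:Z, l) (rev t).
Proof.
elim: t up i => [|p t IHt] up i //=.
rewrite rev_cons -cats1 fern_right_cat IHt /= fsetU0 size_rev sumn_rev.
rewrite negbK addbN addNb negbK fsetUC PoszD -addbA addbb addbF opprD addrA.
by rewrite subrK.
Qed.

Lemma in_dents i l ts t :
  (t \in dents (i, l) ts) = in_solids l (fern_solids true i ts) t.
Proof.
have [n] := ubnP (size ts); elim: n ts i => // n IHn [|p [|d ts]] i ltn.
- by rewrite inE.
- by rewrite /= orbF.
rewrite [dents _ _]/= in_fsetU IHn; last by move: ltn => /=; lia.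
by [].
Qed.

(** * Dented semihexagons and the cored hexagon *)

Lemma s_formula t :
  (s t)%:R = vdm (bases (fern_solids true 0 t)) / (hyperfactorial (osum t))%:R :> rat.
Proof.
rewrite /s.
have -> : dented_semihexagon t = del_solids 0
    (trapezoid 0 0 (osum t + esum t) (osum t)) (fern_solids true 0 t).
  apply/fsetP => -[up [i j]]; rewrite in_del_solids in_fsetD in_dents andbC.
  congr (_ && _); rewrite in_trapezoid in_polygon; case: up => /=; lia.
have sz := size_bases_fern_solids true 0 t.
rewrite -M_del_nil -[[::]]/(tri_row true 0 [::]) M_del_dented ?leq_addr //.
- by rewrite cats0 sz eqxx.
- apply: fits_bases; first by rewrite sz.
  by move=> p /fern_solids_range; rewrite osumDesum.
rewrite cats0; have : uniq (irange 0 (sumn t)) by apply: irange_uniq.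
rewrite -(perm_uniq (s1 := bases (fern_solids true 0 t) ++ bases (fern_solids false 0 t))).
  by rewrite cat_uniq => /andP[].
by apply/permP => P; rewrite count_cat (count_bases_fern_solids P true).
Qed.

(* The blocks of p, c and p + 1 fixed positions are separated by gaps of h
   positions each. *)
Definition gap_sum (z p c h : nat) : rat :=
  crossing_sum z (irange p h ++ irange (p + h + c)%N h)
    (irange 0 p ++ irange (p + h)%N c ++ irange (p + h + c + h)%N p.+1).

(** [x] and [z] have the same parity and the middle argument the opposite one, so the shift is
    [(-1, 1)]. *)
Lemma core_vertexE (x z p h : nat) : (x + z = h + h)%N ->
  core_vertex x (p + p + z + 1) z = ((p + h)%N%:Z, - p%:Z).
Proof.
move=> xz; rewrite /core_vertex !oddD addbb /=.
have -> : odd x = odd z by have := congr1 odd xz; rewrite !oddD addbb => /eqP; case: odd; case: odd.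
rewrite addbT eqxx; case: (odd z) => /=; congr (_, _); lia.
Qed.

(** The base of the core is [p] rows below the west vertex and [p.+1] rows above the east vertex. A
    corner triangle of side [p] completes the upper half to a trapezoid, and one of side [p.+1] the
    lower half. *)
Lemma M_cored_hexagon (x z p c h : nat) : (x + z = h + h)%N ->
  (M (cored_hexagon x (p + p + z + 1) z c))%:R =
  vdm (irange 0 p ++ irange (p + h)%N c) * (hyperfactorial p.+1)%:R *
  gap_sum z p c h /
  ((hyperfactorial (p + c + z))%:R * (hyperfactorial (p.+1 + z))%:R).
Proof.
move=> xz; set sl1 := [:: (0, p); ((p + h)%N%:Z, c)].
set sl2 := [:: ((p + h + c + h)%N%:Z, p.+1)].
have E1 : bases sl1 = irange 0 p ++ irange (p + h)%N c by rewrite /bases /= cats0.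
have E2 : bases sl2 = irange (p + h + c + h)%N p.+1 by rewrite /bases /= cats0.
set q := irange p h ++ irange (p + h + c)%N h.
have full : perm_eq (bases sl1 ++ bases sl2 ++ q) (irange 0 (p + h + c + h + p.+1)).
  apply/permP => P; rewrite E1 E2 !irangeD !add0r !count_cat; lia.
have ufull : uniq (bases sl1 ++ bases sl2 ++ q) by rewrite (perm_uniq full) irange_uniq.
have -> : gap_sum z p c h = crossing_sum z q (bases sl1 ++ bases sl2).
  by rewrite E1 E2 -catA.
have -> : (hyperfactorial p.+1)%:R = vdm (bases sl2) by rewrite E2 vdm_irange.
rewrite -E1; apply: (@M_cut_formula _ (- p%:Z) 0 p (p + h + c + h) _ (h + c + h + p.+1)).
- move=> up i j lj; rewrite in_fsetD (core_vertexE p xz) in_up_triangle.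
  rewrite /hexagon in_polygon in_del_solids in_trapezoid /in_solids /= !in_up_triangle.
  by case: up => /=; lia.
- move=> up i j lj; rewrite in_fsetD (core_vertexE p xz) in_up_triangle.
  rewrite /hexagon in_polygon in_del_solids /reflect_tri in_trapezoid /in_solids /= !in_up_triangle.
  by case: up => /=; lia.
- lia.
- lia.
- by rewrite /fits /=; lia.
- by rewrite /fits /=; lia.
- by move: ufull; rewrite catA -catA uniq_catCA cat_uniq => /and3P[].
- by move: ufull; rewrite cat_uniq => /and3P[].
- by move=> i; rewrite mem_cat !mem_irange; lia.
- by move=> i b1 b2; rewrite E1 E2 !mem_cat !mem_irange; lia.
- by rewrite E1 size_cat !size_irange.
by rewrite E2 size_irange.
Qed.

(** * The region [Qnw] cut along its ferns *)

Lemma in_solids_level l sl up i j : j < l -> in_solids l sl (up, (i, j)) = false.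
Proof.
by move=> jl; apply/negP => /hasP[p _]; rewrite in_up_triangle; case: up => /=; lia.
Qed.

Lemma osum_esum_cat t1 t2 :
  osum (t1 ++ t2) = (osum t1 + if odd (size t1) then esum t2 else osum t2)%N /\
  esum (t1 ++ t2) = (esum t1 + if odd (size t1) then osum t2 else esum t2)%N.
Proof.
elim: t1 => [|p t1 [IHo IHe]]; first by rewrite osum_nil esum_nil.
by rewrite cat_cons !(osum_cons, esum_cons) IHo IHe /=; case: odd; split => /=; lia.
Qed.

Lemma osum_esum_rev t : ~~ odd (size t) ->
  osum (rev t) = esum t /\ esum (rev t) = osum t.
Proof.
suff H : osum (rev t) = (if odd (size t) then osum t else esum t) /\
         esum (rev t) = (if odd (size t) then esum t else osum t).
  by move=> /negPf E; move: H; rewrite E.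
elim: t => [|p t [IHo IHe]]; first by rewrite osum_nil esum_nil.
rewrite rev_cons -cats1; have [-> ->] := osum_esum_cat (rev t) [:: p].
rewrite !(osum_cons, esum_cons) osum_nil esum_nil IHo IHe size_rev /=.
by case: odd => /=; split; lia.
Qed.

(** Read from the left, the right fern starts with its last entry, which points down because [b] has
    even length; hence [false]. *)
Definition upper_ferns (a b c : seq nat) (h : nat) : seq (int * nat) :=
  fern_solids true 0 a ++ fern_solids true (sumn a + h)%N%:Z c
  ++ fern_solids false (sumn a + h + sumn c + h)%N%:Z (rev b).

(* The two extreme triangles of sides L and r complete the part of the hexagon
   below the ferns to a trapezoid. *)
Definition lower_ferns (a b c : seq nat) (h L r : nat) : seq (int * nat) :=
  (- L%:Z, L) :: fern_solids false 0 a ++ fern_solids false (sumn a + h)%N%:Z c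
  ++ fern_solids true (sumn a + h + sumn c + h)%N%:Z (rev b)
  ++ [:: ((sumn a + h + sumn c + h + sumn b)%N%:Z, r)].

Lemma size_upper_ferns a b c h : ~~ odd (size b) ->
  size (bases (upper_ferns a b c h)) = (osum a + osum b + osum c)%N.
Proof.
move=> evb; have [_ Er] := osum_esum_rev evb.
by rewrite !bases_cat !size_cat !size_bases_fern_solids Er; lia.
Qed.

Lemma size_lower_ferns a b c h L r : ~~ odd (size b) ->
  size (bases (lower_ferns a b c h L r)) = (L + (esum a + esum b + esum c) + r)%N.
Proof.
move=> evb; have [Or _] := osum_esum_rev evb.
rewrite bases_cons !bases_cat !size_cat !size_bases_fern_solids Or.
by rewrite /= !size_irange; lia.
Qed.

Section Qnw.

Variables (x z : nat) (y : int) (a b c : seq nat) (h L r : nat).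
Hypotheses (xz : (x + z = h + h)%N) (evb : ~~ odd (size b)).
(** [L] and [r] count the rows from the west and the east vertex up to the line of the ferns. *)
Hypotheses (LE : L%:Z = y + (sumn b - sumn a)%N%:Z)
           (rE : r%:Z = y + (sumn a - sumn b)%N%:Z + 1).

Let O := (osum a + osum b + osum c)%N.
Let E := (esum a + esum b + esum c)%N.
Let W := (sumn a + h + sumn c + h + sumn b)%N.
Let upper := upper_ferns a b c h.
Let lower := lower_ferns a b c h L r.

Lemma in_Qnw up i j : ((up, (i, j)) \in Qnw x y z a c b) =
  [&& 0 <= i, i + 1 <= (W + r)%N%:Z, - (z + E + r)%N%:Z <= j, j + 1 <= (L + z + O)%N%:Z,
      0 <= i + j + (~~ up)%:Z, i + j + 1 + (~~ up)%:Z <= (L + W)%N%:Z,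
      ~~ in_solids L (fern_solids true 0 a ++ fern_solids true (sumn a + h)%N%:Z c
        ++ fern_solids false (sumn a + h + sumn c + h)%N%:Z (rev b)) (up, (i, j))
    & ~~ in_solids L (fern_solids false 0 a ++ fern_solids false (sumn a + h)%N%:Z c
        ++ fern_solids true (sumn a + h + sumn c + h)%N%:Z (rev b))
           (reflect_tri L (up, (i, j)))].
Proof.
have ca := osumDesum a; have cb := osumDesum b; have cc := osumDesum c.
rewrite /Qnw -/O -/E.
have -> : y + z%:Z + O%:Z + (sumn b - sumn a)%N%:Z - (z%:Z + O%:Z) = L%:Z by lia.
have -> : ((x + z)./2 = h)%N by rewrite xz addnn doubleK.
rewrite in_fsetD !in_fsetU fern_leftE evb [true (+) true]/=.
have -> : (x + z + sumn a + sumn b + sumn c)%N%:Z - (sumn b)%:Z =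
          (sumn a + h + sumn c + h)%N%:Z by lia.
rewrite !in_fern_right !in_solids_cat /hexagon in_polygon.
do 6!move: (in_solids _ _ _) => ?; rewrite /O /E /W.
by case: up; lia.
Qed.

(** The line is not below either lateral vertex, so the upper half is a trapezoid as it stands. In
    the lower half the corners extend the outer ferns, and [L + sumn a + 1 = sumn b + r] gives the
    block lengths of [gap_sum]. *)
Lemma M_Qnw_formula : (M (Qnw x y z a c b))%:R =
  vdm (bases upper) * vdm (bases lower) *
  gap_sum z (L + sumn a) (sumn c) h /
  ((hyperfactorial (O + z))%:R * (hyperfactorial (L + E + r + z))%:R).
Proof.
have ca := osumDesum a; have cb := osumDesum b; have cc := osumDesum c.
set q := irange (sumn a) h ++ irange (sumn a + h + sumn c)%N h.
have part P b' i t : (count P (bases (fern_solids b' i t))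
    + count P (bases (fern_solids (~~ b') i t)) = count P (irange i (sumn t)))%N.
  exact: count_bases_fern_solids.
(* Each fern gives its up-pointing triangles to one half and its down-pointing ones to the other;
   together they fill its segment. *)
have blocks P : (count P (bases upper) + count P (bases lower) =
    count P (irange (- L%:Z) L) + count P (irange 0 (sumn a))
    + count P (irange (sumn a + h)%N (sumn c))
    + count P (irange (sumn a + h + sumn c + h)%N (sumn b))
    + count P (irange W r))%N.
  have /= pa := part P true 0 a; have /= pc := part P true (sumn a + h)%N%:Z c.
  have /= pb := part P false (sumn a + h + sumn c + h)%N%:Z (rev b).
  rewrite sumn_rev in pb.
  by rewrite bases_cons !bases_cat !count_cat /W /=; lia.
have full : perm_eq (bases upper ++ bases lower ++ q)
    (irange (- L%:Z) (L + (sumn a + h + sumn c + h + sumn b) + r)).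
  apply/permP => P; rewrite 2!count_cat addnA blocks !irangeD !count_cat.
  rewrite addNr !add0r.
  have -> : - L%:Z + (L + (sumn a + h + sumn c + h + sumn b))%N%:Z = W%:Z by rewrite /W; lia.
  by do 7!move: (count P _) => ?; lia.
have ufull : uniq (bases upper ++ bases lower ++ q).
  by rewrite (perm_uniq full) irange_uniq.
have -> : gap_sum z (L + sumn a) (sumn c) h =
    crossing_sum z q (bases upper ++ bases lower).
  (* The shift moves the left corner from [- L] to 0, where [gap_sum] starts. *)
  rewrite -(crossing_sum_ishift L%:Z) /ishift map_cat -!/(ishift _ _) !ishift_irange.
  rewrite (@perm_crossing_sum _ _ _ (irange 0 (L + sumn a)
    ++ irange (L + sumn a + h)%N (sumn c)
    ++ irange (L + sumn a + h + sumn c + h)%N (L + sumn a).+1)).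
    by rewrite /gap_sum -!PoszD; congr (crossing_sum _ (irange _%:Z _ ++ irange _%:Z _) _); lia.
  have -> : irange 0 (L + sumn a) ++ irange (L + sumn a + h)%N (sumn c)
      ++ irange (L + sumn a + h + sumn c + h)%N (L + sumn a).+1 =
      ishift L (irange (- L%:Z) (L + sumn a) ++ irange (sumn a + h)%N (sumn c)
      ++ irange (sumn a + h + sumn c + h)%N (sumn b + r)).
    rewrite /ishift !map_cat -!/(ishift _ _) !ishift_irange addNr -?PoszD.
    by congr (_ ++ irange _%:Z _ ++ irange _%:Z _); lia.
  apply: perm_map; apply/permP => P; rewrite count_cat blocks !irangeD !count_cat.
  by rewrite addNr -?PoszD -/W; do 5!move: (count P _) => ?; lia.
rewrite (@M_cut_formula _ L%:Z 0 (- L%:Z) W (O + z) (L + W + r) (L + E + r + z) z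
  upper lower q) //.
- move=> up i j lj; rewrite in_Qnw in_del_solids in_trapezoid -/upper.
  rewrite [in_solids _ _ (reflect_tri _ _)]in_solids_level; last lia.
  by case: (in_solids _ _ _); rewrite /O /E /W; case: up; lia.
- move=> up i j lj; rewrite in_Qnw in_del_solids.
  rewrite in_solids_level // in_solids_cons !in_solids_cat /reflect_tri in_trapezoid.
  rewrite in_up_triangle [in_solids _ [:: _] _]/= in_up_triangle orbF.
  by do 3!case: (in_solids _ _ _); rewrite /O /E /W; case: up => /=; lia.
- rewrite /O /W; lia.
- rewrite /E /W; lia.
- apply: fits_bases => [|[i n]]; first by rewrite size_upper_ferns // leq_addr.
  rewrite !mem_cat => /or3P[] /fern_solids_range /=; rewrite ?sumn_rev /W; lia.
- apply: fits_bases => [|[i n]]; first by rewrite size_lower_ferns // leq_addr.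
  rewrite inE !mem_cat inE => /orP[/eqP[-> ->]|/or4P[]] /=; first by rewrite /W; lia.
  + move/fern_solids_range => /=; rewrite /W; lia.
  + move/fern_solids_range => /=; rewrite /W; lia.
  + move/fern_solids_range => /=; rewrite sumn_rev /W; lia.
  by move/eqP=> [-> ->]; rewrite /W /=; lia.
- by move: ufull; rewrite catA -catA uniq_catCA cat_uniq => /and3P[].
- by move: ufull; rewrite cat_uniq => /and3P[].
- by move=> i; rewrite mem_cat !mem_irange /W; lia.
- move=> i b1 b2; rewrite orbA -!mem_cat -catA (perm_mem full) mem_irange.
  by rewrite /W in b1 b2 *; lia.
- by rewrite size_upper_ferns.
by rewrite size_lower_ferns.
Qed.

End Qnw.

(** * The two dented semihexagons of the theorem and the final evaluation *)

(** As the lengths are even, the last entries of [a], [c] and [b] are distances between dents and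
    merge with the adjacent gaps [h]. *)
Lemma s_upper_ferns a b c h : ~~ odd (size a) -> ~~ odd (size b) -> ~~ odd (size c) ->
    (0 < size a)%N -> (0 < size b)%N -> (0 < size c)%N ->
  (s (take (size a).-1 a ++ [:: (nth 0 a (size a).-1 + h)%N]
      ++ take (size c).-1 c
      ++ [:: (nth 0 c (size c).-1 + h + nth 0 b (size b).-1)%N]
      ++ rev (take (size b).-1 b)))%:R =
  vdm (bases (upper_ferns a b c h)) /
    (hyperfactorial (osum a + osum b + osum c))%:R.
Proof.
move=> eva evb evc; rewrite s_formula -(size_upper_ferns a c h evb).
case/lastP: a eva => // a am; case/lastP: b evb => // b bn.
case/lastP: c evc => // c ck; rewrite !size_rcons /= !negbK => oc ob oa _ _ _.
rewrite -!cats1 !take_size_cat // !nth_cat !ltnn !subnn /=.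
set t := _ ++ _.
suff E : bases (fern_solids true 0 t) =
    bases (upper_ferns (a ++ [:: am]) (b ++ [:: bn]) (c ++ [:: ck]) h).
  by rewrite -E size_bases_fern_solids.
rewrite /t /upper_ferns rev_cat.
rewrite -[_ :: _ ++ _ :: rev b]/([:: (am + h)%N] ++ c ++ [:: (ck + h + bn)%N] ++ rev b).
rewrite !fern_solids_cat oa oc /= !sumn_cat /= !addn0 !cats0.
congr (bases (_ ++ fern_solids _ _ _ ++ fern_solids _ _ _)); lia.
Qed.

(** The leading [L] exchanges the parities. The first entry of [c] is now a distance and merges with
    the gap before it; the last entries of [c] and [b] are dents and leave the second gap alone. *)
Lemma s_lower_ferns a b c h L r :
    ~~ odd (size a) -> ~~ odd (size b) -> ~~ odd (size c) -> (0 < size c)%N ->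
  (s ([:: L] ++ a ++ [:: (h + nth 0 c 0)%N] ++ drop 1 c ++ [:: h] ++ rev b ++ [:: r]))%:R =
  vdm (bases (lower_ferns a b c h L r)) /
    (hyperfactorial (L + (esum a + esum b + esum c) + r))%:R.
Proof.
move=> eva evb evc; rewrite s_formula -(size_lower_ferns a c h L r evb).
case: c evc => // c1 c /=; rewrite negbK drop0 => oc _.
set t := L :: _; set k := lower_ferns a b (c1 :: c) h L r.
suff E : bases (fern_solids true 0 t) = ishift L (bases k).
  by rewrite -[in RHS](vdm_ishift L) -(size_map (fun x => x + L%:Z) (bases k))
     -/(ishift L _) -E size_bases_fern_solids.
rewrite /k /lower_ferns /t.
rewrite -[L :: _]/([:: L] ++ a ++ [:: (h + c1)%N] ++ c ++ [:: h] ++ rev b ++ [:: r]).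
rewrite [fern_solids false _ (c1 :: c)]/= !fern_solids_cat /= (negPf eva) oc size_rev.
rewrite (negPf evb) /= !bases_cons !bases_cat /ishift !map_cat -!/(ishift _ _).
rewrite -!bases_fern_solids_ishift !ishift_irange !addn0 !add0r !sumn_rev.
rewrite addNr /= bases_cons !cats0; congr (_ ++ (_ ++ _)).
by congr (bases (fern_solids _ _ _) ++ (bases (fern_solids _ _ _) ++ irange _ _)); lia.
Qed.

(** These are the upper dents of the cored hexagon. The inverse of this value, up to the factor
    H(p), is the product of the quotients of hyperfactorials in c, h and mu + y + h in the
    theorem. *)
Lemma vdm_two_blocks (p c h : nat) :
  vdm (irange 0 p ++ irange (p + h)%N c) =
  (hyperfactorial p)%:R * (hyperfactorial c)%:R *
  ((hyperfactorial (p + h + c))%:R * (hyperfactorial h)%:R /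
   ((hyperfactorial (p + h))%:R * (hyperfactorial (h + c))%:R)).
Proof.
rewrite vdm_cat !vdm_irange -(cross_irange 0) add0r -PoszD mulfK //.
by rewrite mulf_neq0 // hyperfactorial_neq0.
Qed.

Theorem theorem2p8 (x z : nat) (y : int) (a b c : seq nat)
    (hxz : odd x = odd z)
    (ha : (0 < size a)%N) (ha2 : ~~ odd (size a))
    (hb : (0 < size b)%N) (hb2 : ~~ odd (size b))
    (hc : (0 < size c)%N) (hc2 : ~~ odd (size c))
    (hy : -1 <= y) (hy1 : y = -1 -> (sumn a < sumn b)%N) :
  let m := size a in let n := size b in let k := size c in
  let h := ((x + z)./2)%N in
  let mu := maxn (sumn a) (sumn b) in
  let nu := minn (sumn a) (sumn b) in
  let sa := (sumn a)%:Z in let sb := (sumn b)%:Z in let sc := (sumn c)%:Z in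
  let O := (osum a + osum b + osum c)%N%:Z in
  let E := (esum a + esum b + esum c)%N%:Z in
  (M (Qnw x y z a c b))%:R =
    (M (cored_hexagon x (absz (2 * y + z%:Z + 2 * mu%:Z + 1)%R) z (sumn c)))%:R
    * (s (take m.-1 a ++ [:: (nth 0 a m.-1 + h)%N]
          ++ take k.-1 c ++ [:: (nth 0 c k.-1 + h + nth 0 b n.-1)%N]
          ++ rev (take n.-1 b)))%:R
    * (s ([:: absz (y + sb - nu%:Z)%R] ++ a ++ [:: (h + nth 0 c 0)%N] ++ drop 1 c
          ++ [:: h] ++ rev b ++ [:: absz (y + sa + 1 - nu%:Z)%R]))%:R
    * (H (sc + h%:Z) / (H sc * H h%:Z))
    * (H (mu%:Z + y + h%:Z) / H (mu%:Z + sc + y + h%:Z))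
    * ((H (mu%:Z + y + z%:Z + 1) * H (mu%:Z + sc + y + z%:Z))
       / (H (O + z%:Z) * H (`|sa - sb| + E + 2 * y + z%:Z + 1)))
    * ((H O * H (`|sa - sb| + E + 2 * y + 1))
       / (H (mu%:Z + y) * H (mu%:Z + y + 1))) :> rat.
Proof.
move=> m n k h mu nu sa sb sc O E; rewrite {}/m {}/n {}/k.
set L := absz (y + sb - nu%:Z)%R; set r := absz (y + sa + 1 - nu%:Z)%R.
have xz : (x + z = h + h)%N.
  by rewrite addnn /h halfK oddD hxz addbb subn0.
(* This makes y + b - nu nonnegative even for y = -1, so [absz] does not change it. *)
have y1 : (sumn a < sumn b)%N || (0 <= y).
  by case: (eqVneq y (-1)) => [/hy1->//|]; lia.
have LE : L%:Z = y + (sumn b - sumn a)%N%:Z by rewrite /L /sb /nu; lia.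
have rE : r%:Z = y + (sumn a - sumn b)%N%:Z + 1 by rewrite /r /sa /nu; lia.
rewrite (M_Qnw_formula c xz hb2 LE rE) s_upper_ferns // s_lower_ferns //.
set p := (L + sumn a)%N; set Os := (osum a + osum b + osum c)%N.
set Es := (esum a + esum b + esum c)%N.
have pE : p%:Z = mu%:Z + y by rewrite /p /mu; lia.
have -> : absz (2 * y + z%:Z + 2 * mu%:Z + 1)%R = (p + p + z + 1)%N by lia.
rewrite (M_cored_hexagon p (sumn c) xz) vdm_two_blocks.
have Hn e i : i = e%:Z -> H i = (hyperfactorial e)%:R by move=> ->.
rewrite (Hn (h + sumn c)%N (sc + h%:Z)); last by rewrite /sc; lia.
rewrite (Hn (sumn c) sc) // (Hn h h%:Z) //.
rewrite (Hn (p + h)%N (mu%:Z + y + h%:Z)); last by lia.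
rewrite (Hn (p + h + sumn c)%N (mu%:Z + sc + y + h%:Z)); last by rewrite /sc; lia.
rewrite (Hn (p.+1 + z)%N (mu%:Z + y + z%:Z + 1)); last by lia.
rewrite (Hn (p + sumn c + z)%N (mu%:Z + sc + y + z%:Z)); last by rewrite /sc; lia.
rewrite (Hn (Os + z)%N (O + z%:Z)) // (Hn Os O) //.
(* The number of dents of the completed lower half, crossing positions excluded. *)
have dE : `|sa - sb| + E + 2 * y + 1 = (L + Es + r)%N%:Z.
  by rewrite /sa /sb /E -/Es; lia.
rewrite (Hn (L + Es + r + z)%N (`|sa - sb| + E + 2 * y + z%:Z + 1)); last by lia.
rewrite (Hn (L + Es + r)%N) //.
rewrite (Hn p (mu%:Z + y)) // (Hn p.+1 (mu%:Z + y + 1)); last by lia.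
(* Both sides carry the same [gap_sum] and the same two difference products; the rest is an identity
   between nonzero hyperfactorials. *)
field.
by rewrite !hyperfactorial_neq0.
Qed.
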